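(* Let $\mathfrak{g}$ be a $6$-dimensional strongly unimodular almost nilpotent real Lie algebra with nilradical $\mathfrak{n}$ satisfying $\dim\mathfrak{n}^1=1$, where $\mathfrak{n}^1=[\mathfrak{n},\mathfrak{n}]$. Then $\mathfrak{g}$ admits balanced Hermitian structures $(J,g)$ satisfying $J\mathfrak{n}^1\subset\mathfrak{n}$, but no Kähler structures, if and only if it is isomorphic to $$\mathfrak{s}_{5.16}\oplus\mathbb{R}=(f^{23}+f^{46},f^{36},-f^{26},0,0,0).$$ In particular, it is decomposable, $3$-step solvable, of type I (all eigenvalues of $\mathrm{ad}_X$ are purely imaginary for every $X$), and its nilradical $\mathfrak{n}$ is isomorphic to $\mathfrak{h}_3\oplus\mathbb{R}^2$. An example of such a balanced structure on this Lie algebra is provided by the complex structure $Jf_1=-f_5$, $Jf_2=f_3$, $Jf_4=f_6$, together with the metric for which the basis $\{f_1,\dots,f_6\}$ is orthonormal.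
   Context: The nilradical $\mathfrak{n}$ of a solvable Lie algebra $\mathfrak{g}$ is its maximal nilpotent ideal; $\mathfrak{g}$ is almost nilpotent if it is solvable and $\mathfrak{n}$ has codimension one. With $\mathfrak{n}^0=\mathfrak{n}$, $\mathfrak{n}^{l}=[\mathfrak{n},\mathfrak{n}^{l-1}]$, a solvable $\mathfrak{g}$ is strongly unimodular if $\operatorname{tr}(\mathrm{ad}_X|_{\mathfrak{n}^l/\mathfrak{n}^{l+1}})=0$ for all $X\in\mathfrak{g}$, $l\in\mathbb{N}$. A Hermitian structure $(J,g)$ on $\mathfrak{g}$ is an integrable complex structure $J$ (vanishing Nijenhuis tensor) together with a positive definite $J$-orthogonal inner product $g$; $\omega=g(J\cdot,\cdot)$. On a $2n$-dimensional Lie algebra it is balanced if $d\omega^{n-1}=0$ (here $n=3$) and Kähler if $d\omega=0$, $d$ being the Chevalley–Eilenberg differential. $\mathfrak{h}_3$ is the 3-dimensional Heisenberg Lie algebra. $(\phi_1,\dots,\phi_6)$ denotes the Lie algebra with basis $\{f_k\}$ whose dual basis satisfies $df^k=\phi_k$, where $f^{kl}=f^k\wedge f^l$ and $d\alpha(X,Y)=-\alpha([X,Y])$.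
   Formalization: In the example, the formal statement takes Jf_4=-f_6 instead of the printed Jf_4=f_6, because with the printed sign ω=-f^{15}+f^{23}+f^{46} has dω^2=4f^{23456}≠0, so that structure is not balanced. *)

(* Defs.v *)
From HB Require Import structures.
From mathcomp Require Import all_boot all_order all_algebra all_fingroup.
From mathcomp Require Import ring.
From mathcomp Require Import reals.
From mathcomp.real_closed Require Import complex.

Set Implicit Arguments.
Unset Strict Implicit.
Unset Printing Implicit Defensive.

Import Order.TTheory GRing.Theory Num.Theory.
Local Open Scope ring_scope.

HB.mixin Record Vector_isLieAlgebra (K : fieldType) V of Vector K V := {
  lie : V -> V -> V;
  lie_linearl : forall z, linear (lie^~ z);
  lie_linearr : forall z, linear (lie z);
  liexx : forall x, lie x x = 0;
  lie_jacobi : forall x y z,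
    lie x (lie y z) + lie y (lie z x) + lie z (lie x y) = 0
}.

#[short(type="lieAlgType")]
HB.structure Definition LieAlgebra (K : fieldType) :=
  { V of Vector_isLieAlgebra K V & Vector K V }.

HB.instance Definition _ (K : fieldType) (L : lieAlgType K) :=
  bilinear_isBilinear.Build K L L L *:%R *:%R (@lie K L)
    (conj (@lie_linearl K L) (@lie_linearr K L)).

HB.instance Definition _ (K : fieldType) (L : lieAlgType K) (x : L) :=
  GRing.isLinear.Build K L L *:%R (lie x) (lie_linearr x).

Section LieAlgebraNotions.
Context {K : fieldType}.
Implicit Types L M : lieAlgType K.

Definition ad L (x : L) : 'End(L) := linfun (lie x).

(* [U, W]: by bilinearity, brackets of basis vectors span it. *)
Definition brs L (U W : {vspace L}) : {vspace L} :=
  <<[seq lie u w | u <- vbasis U, w <- vbasis W]>>%VS.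

(* n^0 = n, n^(l+1) = [n, n^l] *)
Definition lcs L (U : {vspace L}) (l : nat) : {vspace L} := iter l (brs U) U.

Definition dseries L (l : nat) : {vspace L} :=
  iter l (fun U => brs U U) fullv.

Definition is_ideal L (U : {vspace L}) : bool := (brs fullv U <= U)%VS.

Definition nilpotent_sub L (U : {vspace L}) : Prop :=
  exists l, lcs U l = 0%VS.

Definition solvable_lie L : Prop := exists l, dseries L l = 0%VS.

Definition step_solvable L (k : nat) : Prop :=
  dseries L k = 0%VS /\ forall j, (j < k)%N -> dseries L j <> 0%VS.

Definition is_nilradical L (n : {vspace L}) : Prop :=
  [/\ is_ideal n, nilpotent_sub n
    & forall I : {vspace L},
        is_ideal I -> nilpotent_sub I -> (n <= I)%VS -> I = n].

(* L is almost nilpotent, with nilradical n *)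
Definition almost_nilpotent L (n : {vspace L}) : Prop :=
  [/\ solvable_lie L, is_nilradical n & (\dim n).+1 = \dim {:L}].

(* Trace of the map induced by f on U / W, for f-stable subspaces W <= U. The
   quotient is identified with the complement U :\: W of W in U; addv_pi1 U W
   is the projection of U onto U :\: W with kernel W. *)
Definition quot_trace (V : vectType K) (f : 'End(V)) (U W : {vspace V}) : K :=
  let e := vbasis (U :\: W) in
  \sum_(i < \dim (U :\: W)) coord e i (addv_pi1 U W (f e`_i)).

Definition strongly_unimodular L (n : {vspace L}) : Prop :=
  forall (x : L) (l : nat), quot_trace (ad x) (lcs n l) (lcs n l.+1) = 0.

(* M is isomorphic to the Lie subalgebra U of L *)
Definition isog_sub M L (U : {vspace L}) : Prop :=
  exists f : 'Hom(M, L),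
    [/\ lker f = 0%VS, limg f = U
      & forall x y, f (lie x y) = lie (f x) (f y)].

Definition lie_isog L M : Prop := isog_sub L (fullv : {vspace M}).

Definition decomposable L : Prop :=
  exists I1 I2 : {vspace L},
    [/\ is_ideal I1 /\ is_ideal I2, I1 <> 0%VS, I2 <> 0%VS,
        (I1 + I2 = fullv)%VS & (I1 :&: I2 = 0)%VS].

(* Cochains on L; all the ones used below are alternating and multilinear. *)
Definition form L (k : nat) : Type := ('I_k -> L) -> K.

(* z, followed by x with its entries i and lift i j removed *)
Definition contract L k (x : 'I_k.+2 -> L) (i : 'I_k.+2) (j : 'I_k.+1) (z : L) :
    'I_k.+1 -> L :=
  fun m => if unlift ord0 m is Some m' then x (lift i (lift j m')) else z.

(* Chevalley-Eilenberg differential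
     (d a)(x_0, ..., x_k) =
       \sum_(p < q) (-1)^(p + q) a([x_p, x_q], ..., no x_p, ..., no x_q, ...).
   The pairs p < q are (p, q) = (i, lift i j) with i <= j, so that q = j + 1. *)
Definition ce_d L (k : nat) : form L k -> form L k.+1 :=
  match k return form L k -> form L k.+1 with
  | 0 => fun _ _ => 0
  | k'.+1 => fun a x =>
      \sum_(i < k'.+2) \sum_(j < k'.+1 | (i <= j)%N)
        (-1) ^+ (i + j.+1) * a (contract x i j (lie (x i) (x (lift i j))))
  end.

Definition wedge L (k l : nat) (a : form L k) (b : form L l) :
    form L (k + l) :=
  fun x => (k`! * l`!)%:R^-1 *
    \sum_(s : 'S_(k + l)) (-1) ^+ s *
       a (fun i => x (s (lshift l i))) * b (fun i => x (s (rshift k i))).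

Fixpoint wedge_pow L (w : form L 2) (m : nat) : form L (m * 2) :=
  match m return form L (m * 2) with
  | 0 => fun _ => 1
  | m'.+1 => wedge w (@wedge_pow L w m')
  end.

Definition closed_form L k (a : form L k) : Prop := forall x, ce_d a x = 0.

Definition complex_structure L (J : 'End(L)) : Prop :=
  (forall x, J (J x) = - x) /\
  (forall x y, lie (J x) (J y) - J (lie (J x) y) - J (lie x (J y)) - lie x y
               = 0).

End LieAlgebraNotions.

Arguments wedge_pow {K L} w m _.

Section HermitianStructures.
Context {R : realType}.
Implicit Types L : lieAlgType R.

Definition hermitian_structure L (J : 'End(L)) (g : {dot L for idfun}) : Prop :=
  complex_structure J /\ forall x y, g (J x) (J y) = g x y.

Definition fundamental_form L (J : 'End(L)) (g : {dot L for idfun}) : form L 2 :=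
  fun x => g (J (x ord0)) (x ord_max).

(* d (omega^(n-1)) = 0, where 2n = dim L *)
Definition balanced L (J : 'End(L)) (g : {dot L for idfun}) : Prop :=
  hermitian_structure J g /\
  closed_form (wedge_pow (fundamental_form J g) (\dim {:L})./2.-1).

Definition kaehler L (J : 'End(L)) (g : {dot L for idfun}) : Prop :=
  hermitian_structure J g /\ closed_form (fundamental_form J g).

Definition type_I L : Prop :=
  forall (x : L) (z : R[i]),
    let e := vbasis {:L} in
    eigenvalue (map_mx (real_complex R) (passmx.mxof e e (ad x))) z ->
    complex.Re z = 0.

End HermitianStructures.

(* A Lie algebra (phi_1, ..., phi_n) is realized on 'rV_n, with f_k the k-th
   vector of the canonical basis, 1 <= k <= n. As phi_k = d f^k and
   d f^k (x, y) = - f^k [x, y], the k-th coordinate of [x, y] is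
   - phi_k (x, y). *)
Section StructureEquations.
Context {R : comPzRingType} {n : nat}.
Implicit Types x y : 'rV[R]_n.+1.

Definition fb (k : nat) : 'rV[R]_n.+1 := delta_mx 0 (inord k.-1).
Definition fd (k : nat) x : R := x 0 (inord k.-1).
Definition fw (k l : nat) x y : R := fd k x * fd l y - fd l x * fd k y.

Definition struct_lie (phi : seq ('rV[R]_n.+1 -> 'rV[R]_n.+1 -> R)) x y :
    'rV[R]_n.+1 :=
  \row_k - nth (fun _ _ => 0) phi k x y.

End StructureEquations.

(* s_{5.16} (+) R = (f^23 + f^46, f^36, - f^26, 0, 0, 0) *)
Definition s516R (R : fieldType) : Type := 'rV[R]_6.
HB.instance Definition _ (R : fieldType) := Vector.on (s516R R).

Section S516R.
Variable R : fieldType.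

Definition s516R_lie : s516R R -> s516R R -> s516R R :=
  struct_lie [:: (fun x y => fw 2 3 x y + fw 4 6 x y);
                 fw 3 6;
                 (fun x y => - fw 2 6 x y);
                 (fun _ _ => 0);
                 (fun _ _ => 0);
                 (fun _ _ => 0)].

Fact s516R_linearl z : linear (s516R_lie^~ z).
Proof.
move=> a x y; apply/rowP => -[[|[|[|[|[|[|//]]]]]] ?];
  rewrite !mxE /= /fw /fd ?mxE; ring.
Qed.

Fact s516R_linearr z : linear (s516R_lie z).
Proof.
move=> a x y; apply/rowP => -[[|[|[|[|[|[|//]]]]]] ?];
  rewrite !mxE /= /fw /fd ?mxE; ring.
Qed.

Fact s516R_liexx x : s516R_lie x x = 0.
Proof.
apply/rowP => -[[|[|[|[|[|[|//]]]]]] ?]; rewrite !mxE /= /fw /fd; ring.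
Qed.

Fact s516R_jacobi x y z :
  s516R_lie x (s516R_lie y z) + s516R_lie y (s516R_lie z x)
    + s516R_lie z (s516R_lie x y) = 0.
Proof.
apply/rowP => -[[|[|[|[|[|[|//]]]]]] ?];
  rewrite !mxE /= /fw /fd ?mxE ?inordK //= /fw /fd; ring.
Qed.

End S516R.

HB.instance Definition _ (R : fieldType) :=
  Vector_isLieAlgebra.Build R (s516R R) (@s516R_linearl R) (@s516R_linearr R)
    (@s516R_liexx R) (@s516R_jacobi R).

(* h_3 = (0, 0, f^12) *)
Definition h3 (R : fieldType) : Type := 'rV[R]_3.
HB.instance Definition _ (R : fieldType) := Vector.on (h3 R).

Section H3.
Variable R : fieldType.

Definition h3_lie : h3 R -> h3 R -> h3 R :=
  struct_lie [:: (fun _ _ => 0); (fun _ _ => 0); fw 1 2].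

Fact h3_linearl z : linear (h3_lie^~ z).
Proof.
move=> a x y; apply/rowP => -[[|[|[|//]]] ?];
  rewrite !mxE /= /fw /fd ?mxE; ring.
Qed.

Fact h3_linearr z : linear (h3_lie z).
Proof.
move=> a x y; apply/rowP => -[[|[|[|//]]] ?];
  rewrite !mxE /= /fw /fd ?mxE; ring.
Qed.

Fact h3_liexx x : h3_lie x x = 0.
Proof. apply/rowP => -[[|[|[|//]]] ?]; rewrite !mxE /= /fw /fd; ring. Qed.

Fact h3_jacobi x y z :
  h3_lie x (h3_lie y z) + h3_lie y (h3_lie z x) + h3_lie z (h3_lie x y) = 0.
Proof.
apply/rowP => -[[|[|[|//]]] ?];
  rewrite !mxE /= /fw /fd ?mxE ?inordK //= /fw /fd; ring.
Qed.

End H3.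

HB.instance Definition _ (R : fieldType) :=
  Vector_isLieAlgebra.Build R (h3 R) (@h3_linearl R) (@h3_linearr R)
    (@h3_liexx R) (@h3_jacobi R).

Definition abelian_lie (R : fieldType) (n : nat) : Type := 'rV[R]_n.
HB.instance Definition _ (R : fieldType) (n : nat) := Vector.on (abelian_lie R n).

Section AbelianLie.
Variables (R : fieldType) (n : nat).

Definition abelian_lie_lie (x y : abelian_lie R n) : abelian_lie R n := 0.

Fact abelian_lie_linear (z : abelian_lie R n) :
  linear (fun _ : abelian_lie R n => 0 : abelian_lie R n).
Proof. by move=> a x y; rewrite scaler0 addr0. Qed.

Fact abelian_lie_jacobi (x y z : abelian_lie R n) :
  0 + 0 + 0 = 0 :> abelian_lie R n.
Proof. by rewrite !addr0. Qed.

HB.instance Definition _ :=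
  @Vector_isLieAlgebra.Build R (abelian_lie R n) abelian_lie_lie
    abelian_lie_linear abelian_lie_linear (fun=> erefl) abelian_lie_jacobi.
End AbelianLie.

Section DirectSum.
Variables (K : fieldType) (L M : lieAlgType K).
Implicit Types x y z : (L * M)%type.

Definition pair_lie x y : (L * M)%type := (lie x.1 y.1, lie x.2 y.2).

Fact pair_lie_linearl z : linear (pair_lie^~ z).
Proof. by move=> a x y; rewrite /pair_lie /= !lie_linearl. Qed.

Fact pair_lie_linearr z : linear (pair_lie z).
Proof. by move=> a x y; rewrite /pair_lie /= !lie_linearr. Qed.

Fact pair_liexx x : pair_lie x x = 0.
Proof. by rewrite /pair_lie !liexx. Qed.

Fact pair_lie_jacobi x y z :
  pair_lie x (pair_lie y z) + pair_lie y (pair_lie z x)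
    + pair_lie z (pair_lie x y) = 0.
Proof. by congr pair; rewrite /= lie_jacobi. Qed.

HB.instance Definition _ :=
  Vector_isLieAlgebra.Build K (L * M)%type pair_lie_linearl pair_lie_linearr
    pair_liexx pair_lie_jacobi.
End DirectSum.

Section Example.
Variable R : realType.
Local Notation s := (s516R R).

(* The complex structure J f_1 = - f_5, J f_2 = f_3, J f_4 = - f_6.
   With J f_4 = f_6 instead, omega = - f^15 + f^23 + f^46 for the orthonormal
   metric, and d (omega ^ omega) = 4 f^23456 is not zero. *)
Definition J_ex : 'End(s) := linfun (fun x : s =>
  (fd 1 x *: - fb 5 + fd 2 x *: fb 3 + fd 3 x *: - fb 2
   + fd 4 x *: - fb 6 + fd 5 x *: fb 1 + fd 6 x *: fb 4 : s)).

(* The inner product for which f_1, ..., f_6 are orthonormal *)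
Definition g_ex (x y : s) : R := \sum_(k < 6) x 0 k * y 0 k.

Fact g_ex_bilinear : bilinear_for *%R *%R g_ex.
Proof.
split=> [z a x y|z a x y] /=; rewrite /g_ex mulr_sumr -big_split /=;
  by apply: eq_bigr => k _; rewrite !mxE; ring.
Qed.

HB.instance Definition _ :=
  bilinear_isBilinear.Build R s s R *%R *%R g_ex g_ex_bilinear.

Fact g_ex_sym x y : g_ex x y = (-1) ^+ false * idfun (g_ex y x).
Proof.
by rewrite expr0 mul1r /=; apply: eq_bigr => k _; rewrite mulrC.
Qed.

HB.instance Definition _ :=
  isHermitianSesquilinear.Build R s false idfun g_ex g_ex_sym.

Fact g_ex_gt0 x : x != 0 -> 0 < g_ex x x.
Proof.
move=> nzx; have ge0 k : true -> 0 <= x 0 k * x 0 k by rewrite -expr2 sqr_ge0.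
rewrite lt_def sumr_ge0 // andbT; apply: contra nzx => /eqP/psumr_eq0P x0.
apply/eqP/rowP => k; rewrite mxE.
by have /eqP := x0 ge0 k isT; rewrite mulf_eq0 orbb => /eqP.
Qed.

HB.instance Definition _ := isDotProduct.Build R s g_ex g_ex_gt0.
End Example.

(* Main.v *)
(** Write n for the nilradical. Nilpotency of n and strong unimodularity make
    the line n^1 = <z> central in g.

    If (J, g) is balanced with J n^1 in n, let x be a unit normal of n,
    e = - J x, y = J z, and complete to an orthonormal frame e, x, z, y, u,
    v = J u. Integrability makes ad_y commute with J, so ad_y vanishes on u and
    v, and it determines [x, v] from [x, u]. Since d(omega^2) = 0 and the trace
    of ad_x on n/n^1 is 0, the brackets are reduced to a few constants, and the
    Jacobi identity leaves [u, v] = a z, [x, e] = a z and a rotation of speed t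
    of the (u, v)-plane under ad_x, up to central terms; a <> 0 since n is not
    abelian, t <> 0 since g is not nilpotent. Absorbing the central terms gives
    s_{5.16} (+) R.

    Conversely, s_{5.16} (+) R carries no Kaehler structure: with z = f_1
    central, d omega = 0 makes J z orthogonal to [g, g] and ad_{J z} commutes
    with J, so z is not in the image of ad_{J z}. In coordinates this forces
    ad_{J z} = 0, and then d omega = 0 makes z orthogonal to [g, g], which
    contains z. *)
Require Import Defs.
From HB Require Import structures.
From mathcomp Require Import all_boot all_order all_algebra all_fingroup.
From mathcomp Require Import ring lra.
From mathcomp Require Import reals.
From mathcomp.real_closed Require Import complex.
From Stdlib Require Import FunctionalExtensionality.
Set Implicit Arguments.
Unset Strict Implicit.
Unset Printing Implicit Defensive.
Import Order.TTheory GRing.Theory Num.Theory.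
Local Open Scope ring_scope.

(** * Brackets of subspaces, ideals and the lower central series *)

Section LieGeneral.
Context {K : fieldType} {L : lieAlgType K}.
Implicit Types (x y z : L) (U W X : {vspace L}).

Lemma lieDl z x y : lie (x + y) z = lie x z + lie y z.
Proof. exact: linearDl. Qed.

Lemma lieDr z x y : lie z (x + y) = lie z x + lie z y.
Proof. exact: linearDr. Qed.

Lemma lieZl z a x : lie (a *: x) z = a *: lie x z.
Proof. exact: linearZl_LR. Qed.

Lemma lieZr z a x : lie z (a *: x) = a *: lie z x.
Proof. exact: linearZr_LR. Qed.

Lemma lieNl z x : lie (- x) z = - lie x z.
Proof. exact: linearNl. Qed.

Lemma lieNr z x : lie z (- x) = - lie z x.
Proof. exact: linearNr. Qed.

Lemma lie0l z : lie 0 z = 0.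
Proof. exact: linear0l. Qed.

Lemma lie0r z : lie z 0 = 0.
Proof. exact: linear0r. Qed.

Definition lieE := (lieDl, lieDr, lieZl, lieZr, lieNl, lieNr, lie0l, lie0r).

Lemma lieC x y : lie x y = - lie y x.
Proof.
have := liexx (x + y); rewrite lieDl !lieDr !liexx addr0 add0r.
by move=> /addr0_eq <-; rewrite opprK.
Qed.

Lemma lie_der x y z : lie x (lie y z) = lie (lie x y) z + lie y (lie x z).
Proof.
have := lie_jacobi x y z; rewrite (lieC z x) lieNr (lieC z (lie x y)).
by move/eqP; rewrite addrAC subr_eq0 => /eqP/(canRL (addrNK _)); rewrite addrC.
Qed.

Lemma mem_brs U W x y : x \in U -> y \in W -> lie x y \in brs U W.
Proof.
move=> /coord_vbasis-> /coord_vbasis->.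
rewrite linear_sumlz; apply: memv_suml => i _.
rewrite linear_sumr; apply: memv_suml => j _ /=.
rewrite lieZl lieZr; do 2!apply: memvZ; apply: memv_span.
by apply: allpairs_f; apply: mem_nth; rewrite size_tuple.
Qed.

Lemma brs_subP U W X :
  reflect (forall x y, x \in U -> y \in W -> lie x y \in X) (brs U W <= X)%VS.
Proof.
apply: (iffP idP) => [/subvP sX x y xU yW | H].
  by apply/sX/mem_brs.
apply/span_subvP => _ /allpairsP[[x y] /= [xU yW ->]].
by apply: H; apply: vbasis_mem.
Qed.

Lemma brsS U1 U2 W1 W2 :
  (U1 <= U2)%VS -> (W1 <= W2)%VS -> (brs U1 W1 <= brs U2 W2)%VS.
Proof.
move=> /subvP s1 /subvP s2; apply/brs_subP => x y xU yW.
by apply: mem_brs; [apply: s1|apply: s2].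
Qed.

Lemma idealP U :
  reflect (forall x y, y \in U -> lie x y \in U) (is_ideal U).
Proof.
by apply: (iffP (brs_subP _ _ _)) => H x y; [apply: H; rewrite memvf|move=> _; apply: H].
Qed.

Lemma lcsS U l : lcs U l.+1 = brs U (lcs U l). Proof. by []. Qed.

Lemma lcs_sub U l : is_ideal U -> (lcs U l.+1 <= lcs U l)%VS.
Proof.
move=> /idealP idU; elim: l => [|l IH].
  by apply/brs_subP => x y _; apply: idU.
by rewrite [lcs U l.+2]lcsS [X in (_ <= X)%VS]lcsS; apply: brsS.
Qed.

Lemma lcs_stat U l k : lcs U l.+1 = lcs U l -> lcs U (k + l) = lcs U l.
Proof. by move=> e; elim: k => // k IH; rewrite addSn lcsS IH -lcsS. Qed.

Lemma lcs_eq0 U l k : lcs U l = 0%VS -> (l <= k)%N -> lcs U k = 0%VS.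
Proof.
move=> e0 /subnK <-; rewrite lcs_stat // lcsS e0; apply/eqP.
rewrite -subv0; apply/brs_subP => x y _; rewrite !memv0 => /eqP->.
by rewrite lie0r.
Qed.

(** The elements that [ad x] sends into [U, U] form a subspace, so it is enough to test brackets of
    elements of [U], where [ad x] is a derivation. *)
Lemma ideal_brs U : is_ideal U -> is_ideal (brs U U).
Proof.
move=> /idealP idU; apply/idealP => x y yU.
have /subvP : (brs U U <= linfun (lie x) @^-1: brs U U)%VS.
  apply/brs_subP => u w uU wU; rewrite -memv_preim lfunE /= lie_der.
  by apply: memvD; apply: mem_brs => //; apply: idU.
by move/(_ _ yU); rewrite -memv_preim lfunE.
Qed.

End LieGeneral.

(** * Traces on subspaces and quotients *)

Section QuotTrace.
Context {K : fieldType} {V : vectType K}.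

(** Expanding each [X]_i[in]Y[, and each]f Y[_j] in [X], turns both sums into the same double sum;
    stability of [U] permits the second expansion. *)
Lemma trace_basis_eq k (X Y : k.-tuple V) (U : {vspace V}) (f : 'End(V)) :
  basis_of U X -> basis_of U Y -> (f @: U <= U)%VS ->
  \sum_i coord X i (f X`_i) = \sum_i coord Y i (f Y`_i).
Proof.
move=> bX bY fU; have st u : u \in U -> f u \in U.
  by move=> uU; apply: (subvP fU); apply: memv_img.
have mX (i : 'I_k) : X`_i \in U.
  by apply: (basis_mem bX); rewrite mem_nth ?size_tuple.
have mY (i : 'I_k) : Y`_i \in U.
  by apply: (basis_mem bY); rewrite mem_nth ?size_tuple.
transitivity (\sum_(i < k) \sum_(j < k) coord Y j X`_i * coord X i (f Y`_j)).
  apply: eq_bigr => i _.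
  rewrite {1}(coord_basis bY (mX i)) !linear_sum /=.
  by apply: eq_bigr => j _; rewrite !linearZ.
rewrite exchange_big /=; apply: eq_bigr => j _.
rewrite {2}(coord_basis bX (st _ (mY j))) linear_sum /=.
by apply: eq_bigr => i _; rewrite linearZ mulrC.
Qed.

(** Frees the trace from the complement chosen in [quot_trace]: any basis [Y] of [U] modulo [W] will
    do. The projection [p] kills [W] and carries [Y] to a basis of that complement, where [M] is the
    matrix of the induced map. *)
Lemma quot_trace_eq k (Y : k.-tuple V) (U W : {vspace V}) (f : 'End(V))
    (M : 'M[K]_k) :
    (W <= U)%VS -> (f @: U <= U)%VS -> (f @: W <= W)%VS ->
    (<<Y>> + W = U)%VS -> (k + \dim W = \dim U)%N ->
    (forall i : 'I_k, f Y`_i - \sum_j M i j *: Y`_j \in W) ->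
  quot_trace f U W = \tr M.
Proof.
move=> sWU fU fW YW dimk HM.
pose p := addv_pi1 U W.
have pW w : w \in W -> p w = 0.
  move=> wW; have := @addv_pi1_pi2 _ _ U W w.
  rewrite (subvP (addvSr U W)) // (addv_pi2_id _ wW) => /(_ isT).
  by rewrite -[X in _ = X]add0r => /addIr.
have pU u : u \in U -> u - p u \in W.
  move=> uU; have uUW : u \in (U + W)%VS by apply: (subvP (addvSl U W)).
  rewrite -{1}(addv_pi1_pi2 uUW) addrC addKr; exact: memv_pi2.
have pD u : p u \in (U :\: W)%VS by apply: memv_pi.
have sDU : (U :\: W <= U)%VS by apply: diffvSl.
have pid u : u \in (U :\: W)%VS -> p u = u.
  by apply: daddv_pi_id; rewrite capv_diff.
have dimD : \dim (U :\: W) = k.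
  apply/eqP; rewrite -(eqn_add2r (\dim W)) dimk.
  rewrite -dimv_disjoint_sum ?capv_diff // addv_diff.
  by rewrite (addv_idPl sWU).
(* [u] and [p u] differ by an element of [W], which [f] preserves and [p] kills. *)
have fp u : u \in U -> p (f (p u)) = p (f u).
  move=> uU; apply/eqP; rewrite -subr_eq0 -!linearB -opprB !linearN oppr_eq0 /=.
  by apply/eqP/pW/(subvP fW)/memv_img/pU.
have mY (i : 'I_k) : Y`_i \in U.
  rewrite -YW; apply: (subvP (addvSl _ _)); apply: memv_span.
  by rewrite mem_nth ?size_tuple.
rewrite /quot_trace /= -/p; move: (vbasisP (U :\: W)).
move: (vbasis (U :\: W)); rewrite dimD => e be.
(* Spanning suffices, since the number of vectors is the dimension. *)
have bpY : basis_of (U :\: W) (map_tuple p Y).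
  rewrite basisEdim size_tuple dimD leqnn andbT.
  apply/subvP => u uD; have : u \in (<<Y>> + W)%VS by rewrite YW; apply: (subvP sDU).
  case/memv_addP => y yY [w wW uyw]; rewrite -(pid u uD) uyw linearD /= (pW w) // addr0.
  rewrite (coord_span yY) linear_sum; apply: memv_suml => i _ /=.
  by rewrite linearZ; apply/memvZ/memv_span/map_f; rewrite mem_nth ?size_tuple.
have -> : \sum_(i < k) coord e i (p (f e`_i)) =
   \sum_(i < k) coord e i ((p \o f)%VF e`_i).
  by apply: eq_bigr => i _; rewrite lfunE.
rewrite (trace_basis_eq be bpY).
  apply: eq_bigr => i _; rewrite lfunE /= (nth_map 0) ?size_tuple //.
  rewrite fp //.
  have -> : p (f Y`_i) = \sum_j M i j *: (map_tuple p Y)`_j.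
    rewrite -[f _](subrK (\sum_j M i j *: Y`_j)) linearD /= (pW _ (HM i)) add0r.
    rewrite linear_sum; apply: eq_bigr => j _.
    by rewrite linearZ /= (nth_map 0) ?size_tuple.
  by rewrite coord_sum_free // (basis_free bpY).
by apply/subvP => _ /memv_imgP[u uD ->]; rewrite lfunE /=.
Qed.
End QuotTrace.

(** * Alternating sums over small symmetric groups *)

Lemma sum_perm_succ (V : nmodType) k (F : 'S_k.+1 -> V) :
  \sum_s F s = \sum_i \sum_(s : 'S_k) F (lift_perm ord0 i s).
Proof.
rewrite pair_big /= (reindex (fun r : 'I_k.+1 * 'S_k => lift_perm ord0 r.1 r.2)) //=.
(* Both sides have (k+1)! elements, so injectivity is enough: the image of 0 recovers [i], the other
   values recover [s]. *)
apply: onW_bij; apply: inj_card_bij => [[i s] [j s'] /= ij|].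
  have eij : i = j by rewrite -(lift_perm_id ord0 i s) ij lift_perm_id.
  subst j; congr pair; apply/permP => l; apply: (@lift_inj _ i).
  by rewrite -!(lift_perm_lift ord0) ij.
by rewrite card_prod card_ord !card_Sn factS.
Qed.

Lemma sum_perm0 (V : nmodType) (F : 'S_0 -> V) : \sum_s F s = F 1%g.
Proof.
rewrite (bigD1 1%g) //= big1 ?addr0 // => s /eqP[].
by apply/permP => -[].
Qed.

Lemma alt_sum2 (K : pzRingType) (F : nat -> nat -> K) :
  \sum_(s : 'S_2) (-1) ^+ s * F (s ord0) (s (lift ord0 ord0)) = F 0%N 1%N - F 1%N 0%N.
Proof.
do 2!rewrite !sum_perm_succ !big_ord_recl !big_ord0.
rewrite !sum_perm0 !lift_perm_lift !lift_perm_id !odd_lift_perm !odd_perm1 /=.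
by rewrite /bump /= expr0 expr1 !addr0 mul1r mulN1r.
Qed.

(** The 24 permutations fall into the three pairings of four points, 8 for each; antisymmetry makes
    equal the terms of one pairing. The right side is 8 times a Pfaffian. *)
Lemma alt_sum4 (K : comPzRingType) (b : nat -> nat -> K) :
  (forall i j, b i j = - b j i) ->
  \sum_(s : 'S_4) (-1) ^+ s *
     b (s ord0) (s (lift ord0 ord0)) * b (s (lift ord0 (lift ord0 ord0)))
      (s (lift ord0 (lift ord0 (lift ord0 ord0)))) =
  8%:R * (b 0%N 1%N * b 2%N 3%N - b 0%N 2%N * b 1%N 3%N + b 0%N 3%N * b 1%N 2%N).
Proof.
move=> bC; rewrite sum_perm_succ.
under eq_bigr => i _.
  under eq_bigr => s _.
    rewrite !lift_perm_lift lift_perm_id odd_lift_perm.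
    over.
  rewrite sum_perm_succ.
  under eq_bigr => j _.
    under eq_bigr => s _.
      rewrite !lift_perm_lift lift_perm_id odd_lift_perm.
      over.
    rewrite sum_perm_succ.
    under eq_bigr => k _.
     under eq_bigr => s _.
      rewrite !lift_perm_lift lift_perm_id odd_lift_perm.
      over.
     rewrite sum_perm_succ big_ord_recl big_ord0 sum_perm0 addr0.
     rewrite lift_perm_id odd_lift_perm odd_perm1.
     over.
    rewrite !big_ord_recl big_ord0 /=.
    over.
  rewrite !big_ord_recl big_ord0 /=.
  over.
rewrite !big_ord_recl big_ord0 /bump /= !addr0.
rewrite (bC 1%N 0%N) (bC 2%N 0%N) (bC 3%N 0%N) (bC 2%N 1%N) (bC 3%N 1%N) (bC 3%N 2%N).
ring.
Qed.

(** * Explicit values of the square of a 2-form and of the differentials *)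

Section Forms.
Context {R : realType} {L : lieAlgType R}.

(** The value of b ^ b on four vectors, twice the Pfaffian of the matrix of [b] on them. *)
Definition form_sq (b : L -> L -> R) u v w z : R :=
  2%:R * (b u v * b w z - b u w * b v z + b u z * b v w).

(* The arguments of a form are given by a sequence on nat, so that the nested
   lifts produced by the expansions reduce to numerals. *)
Lemma wedge_pow2 (b : L -> L -> R) (x : nat -> L) : (forall u v, b u v = - b v u) ->
  wedge_pow (fun y : 'I_2 -> L => b (y ord0) (y ord_max)) 2 (fun i => x i) =
  form_sq b (x 0%N) (x 1%N) (x 2%N) (x 3%N).
Proof.
move=> bC; rewrite /wedge_pow /wedge /=.
(* The recursion ends with the wedge of [b] and the constant 1, which is [b] again: the factor 1/2!
   compensates for two equal terms. *)
have w1 (y : 'I_2 -> L) : ((2`! * (0 * 2)`!)%:R^-1 * \sum_(s : 'S_(2 + 0 * 2)) (-1) ^+ s *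
   b (y (s (lshift (0 * 2) ord0))) (y (s (lshift (0 * 2) ord_max))) * 1) =
   b (y ord0) (y ord_max).
  pose Y k := y (inord k).
  have yY i : y i = Y i by rewrite /Y inord_val.
  have -> : lshift (0 * 2) (ord0 : 'I_2) = ord0 by apply: val_inj.
  have -> : lshift (0 * 2) (ord_max : 'I_2) = lift ord0 ord0 by apply: val_inj.
  under eq_bigr => s _ do rewrite mulr1 !yY.
  rewrite (alt_sum2 (fun i j => b (Y i) (Y j))) !yY (bC (Y 1%N)) opprK !factS fact0 /=.
  by field.
under eq_bigr => s _ do
  rewrite [X in _ * X](w1 (fun i => x (s (rshift 2 i)))).
have -> : lshift (1 * 2) (ord0 : 'I_2) = ord0 by apply: val_inj.
have -> : lshift (1 * 2) (ord_max : 'I_2) = lift ord0 ord0 by apply: val_inj.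
have -> : rshift 2 (ord0 : 'I_(1 * 2)) = lift ord0 (lift ord0 ord0) by apply: val_inj.
have -> : rshift 2 (ord_max : 'I_(1 * 2)) =
  lift ord0 (lift ord0 (lift ord0 ord0)) by apply: val_inj.
rewrite /form_sq (alt_sum4 (b := fun i j => b (x i) (x j))) // !factS fact0.
by field.
Qed.

Lemma contract0 k (x : 'I_k.+2 -> L) i j z : contract x i j z ord0 = z.
Proof. by rewrite /contract unlift_none. Qed.

Lemma contractS k (x : 'I_k.+2 -> L) i j z m :
  contract x i j z (lift ord0 m) = x (lift i (lift j m)).
Proof. by rewrite /contract liftK. Qed.

Lemma ce_d2 (b : L -> L -> R) (x : nat -> L) :
  ce_d (fun y : 'I_2 -> L => b (y ord0) (y ord_max)) (fun i : 'I_3 => x i) =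
  - b (lie (x 0%N) (x 1%N)) (x 2%N) + b (lie (x 0%N) (x 2%N)) (x 1%N)
  - b (lie (x 1%N) (x 2%N)) (x 0%N).
Proof.
have maxE : ord_max = lift ord0 ord0 :> 'I_2 by apply: val_inj.
rewrite /ce_d.
under eq_bigr => i _ do under eq_bigr => j _ do rewrite contract0 maxE contractS.
under eq_bigr => i _ do rewrite big_mkcond.
rewrite !big_ord_recl !big_ord0 /= /bump /= ?(addr0, add0r, expr0, expr1).
ring.
Qed.

(** The ten terms, one for each pair p < q among five vectors, of the differential of a 4-form. *)
Definition ce_sum4 (B : L -> L -> L -> L -> R) (x : nat -> L) : R :=
  - B (lie (x 0%N) (x 1%N)) (x 2%N) (x 3%N) (x 4%N)
  + B (lie (x 0%N) (x 2%N)) (x 1%N) (x 3%N) (x 4%N)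
  - B (lie (x 0%N) (x 3%N)) (x 1%N) (x 2%N) (x 4%N)
  + B (lie (x 0%N) (x 4%N)) (x 1%N) (x 2%N) (x 3%N)
  - B (lie (x 1%N) (x 2%N)) (x 0%N) (x 3%N) (x 4%N)
  + B (lie (x 1%N) (x 3%N)) (x 0%N) (x 2%N) (x 4%N)
  - B (lie (x 1%N) (x 4%N)) (x 0%N) (x 2%N) (x 3%N)
  - B (lie (x 2%N) (x 3%N)) (x 0%N) (x 1%N) (x 4%N)
  + B (lie (x 2%N) (x 4%N)) (x 0%N) (x 1%N) (x 3%N)
  - B (lie (x 3%N) (x 4%N)) (x 0%N) (x 1%N) (x 2%N).

Lemma ce_d4 (B : L -> L -> L -> L -> R) (x : nat -> L) (a : Defs.form L 4) :
  (forall y : nat -> L, a (fun i => y i) = B (y 0%N) (y 1%N) (y 2%N) (y 3%N)) ->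
  ce_d a (fun i : 'I_5 => x i) = ce_sum4 B x.
Proof.
move=> aE.
(* Every tuple of four vectors is the restriction of a sequence on nat, obtained through [inord]. *)
have {}aE (y : 'I_4 -> L) : a y = B (y ord0) (y (lift ord0 ord0))
    (y (lift ord0 (lift ord0 ord0))) (y (lift ord0 (lift ord0 (lift ord0 ord0)))).
  pose Y k := y (inord k).
  have yY i : y i = Y i by rewrite /Y inord_val.
  by rewrite !yY /= -(aE Y); congr a; apply: functional_extensionality => i.
rewrite /ce_d.
under eq_bigr => i _ do
  under eq_bigr => j _ do rewrite aE contract0 !contractS.
under eq_bigr => i _ do rewrite big_mkcond.
rewrite !big_ord_recl !big_ord0 /= /bump /= ?(addr0, add0r, expr0, expr1).
by rewrite /ce_sum4 !add0n !addn0 /=; ring.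
Qed.

Lemma ce_d_sq (b : L -> L -> R) (x : nat -> L) :
  (forall u v, b u v = - b v u) ->
  ce_d (wedge_pow (fun y : 'I_2 -> L => b (y ord0) (y ord_max)) 2)
    (fun i : 'I_5 => x i) = ce_sum4 (form_sq b) x.
Proof. by move=> bC; apply: ce_d4 => y; apply: wedge_pow2. Qed.
End Forms.

(** * The complex structure of the example *)

Section JExample.
Variable R : realType.
Local Notation s := (s516R R).

(** The function under [linfun] in [J_ex], named so that its linearity can be registered and [lfunE]
    can evaluate [J_ex]. *)
Definition J_fun (x : s) : s :=
  fd 1 x *: - fb 5 + fd 2 x *: fb 3 + fd 3 x *: - fb 2
   + fd 4 x *: - fb 6 + fd 5 x *: fb 1 + fd 6 x *: fb 4.

Fact J_fun_linear : linear J_fun.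
Proof. by move=> a x y; apply/rowP => i; rewrite /J_fun /fd !mxE; ring. Qed.

HB.instance Definition _ := GRing.isLinear.Build R s s *:%R J_fun J_fun_linear.

Lemma J_exE x : J_ex R x = J_fun x.
Proof. exact: (lfunE J_fun). Qed.
End JExample.

(** * Algebras isomorphic to s_{5.16} (+) R, studied in coordinates *)

Section S516Coordinates.
Context {R : realType} {L : lieAlgType R} (phi : 'Hom(L, s516R R)).
Hypothesis phi_inj : lker phi = 0%VS.
Hypothesis phi_surj : limg phi = fullv.
Hypothesis phi_lie : forall x y, phi (lie x y) = lie (phi x) (phi y).
Implicit Types x y z w : L.

(** The dual basis f^1, ..., f^6 pulled back by [phi], numbered from 1. By [co_ext] an identity
    between vectors becomes six scalar identities. *)
Definition co k x : R := fd k (phi x).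

Lemma coD k x y : co k (x + y) = co k x + co k y.
Proof. by rewrite /co /fd linearD mxE. Qed.

Lemma coN k x : co k (- x) = - co k x.
Proof. by rewrite /co /fd linearN mxE. Qed.

Lemma coZ k a x : co k (a *: x) = a * co k x.
Proof. by rewrite /co /fd linearZ mxE. Qed.

Lemma co0 k : co k 0 = 0.
Proof. by rewrite /co /fd linear0 mxE. Qed.

Lemma co_ext x y :
  co 1 x = co 1 y -> co 2 x = co 2 y -> co 3 x = co 3 y ->
  co 4 x = co 4 y -> co 5 x = co 5 y -> co 6 x = co 6 y -> x = y.
Proof.
move=> e1 e2 e3 e4 e5 e6.
have /lker0P injphi : lker phi == 0%VS by rewrite phi_inj.
apply: injphi; apply/rowP => i; rewrite -(inord_val i).
by case: i => -[|[|[|[|[|[|//]]]]]] ? /=.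
Qed.

Definition vec (a1 a2 a3 a4 a5 a6 : R) : L :=
  (phi^-1)%VF (\row_i [:: a1; a2; a3; a4; a5; a6]`_i : s516R R).

Lemma co_vec k a1 a2 a3 a4 a5 a6 : (0 < k <= 6)%N ->
  co k (vec a1 a2 a3 a4 a5 a6) = [:: a1; a2; a3; a4; a5; a6]`_k.-1.
Proof.
case: k => // k; rewrite ltnS => /= k6.
by rewrite /co /vec limg_lfunVK ?phi_surj ?memvf // /fd mxE inordK.
Qed.

Definition coE := (coD, coN, coZ, co0).

Lemma co_lie x y :
  [/\ co 1 (lie x y) = - (co 2 x * co 3 y - co 3 x * co 2 y
                          + (co 4 x * co 6 y - co 6 x * co 4 y)),
      co 2 (lie x y) = - (co 3 x * co 6 y - co 6 x * co 3 y),
      co 3 (lie x y) = co 2 x * co 6 y - co 6 x * co 2 y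
    & [/\ co 4 (lie x y) = 0, co 5 (lie x y) = 0 & co 6 (lie x y) = 0]].
Proof.
rewrite /co phi_lie; do !split; rewrite {1}/fd mxE inordK //= /fw ?oppr0 //.
by rewrite opprK.
Qed.

Lemma co1_lie x y : co 1 (lie x y) =
  - (co 2 x * co 3 y - co 3 x * co 2 y + (co 4 x * co 6 y - co 6 x * co 4 y)).
Proof. by case: (co_lie x y). Qed.

Lemma co2_lie x y : co 2 (lie x y) = - (co 3 x * co 6 y - co 6 x * co 3 y).
Proof. by case: (co_lie x y). Qed.

Lemma co3_lie x y : co 3 (lie x y) = co 2 x * co 6 y - co 6 x * co 2 y.
Proof. by case: (co_lie x y). Qed.

Lemma co456_lie x y :
  [/\ co 4 (lie x y) = 0, co 5 (lie x y) = 0 & co 6 (lie x y) = 0].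
Proof. by case: (co_lie x y). Qed.

Lemma co4_lie x y : co 4 (lie x y) = 0.
Proof. by case: (co456_lie x y). Qed.

Lemma co5_lie x y : co 5 (lie x y) = 0.
Proof. by case: (co456_lie x y). Qed.

Lemma co6_lie x y : co 6 (lie x y) = 0.
Proof. by case: (co456_lie x y). Qed.

Definition colieE := (co1_lie, co2_lie, co3_lie, co4_lie, co5_lie, co6_lie).

Fact co_linear k : linear (co k : L -> R^o).
Proof. by move=> a x y; rewrite coD coZ. Qed.

HB.instance Definition _ k :=
  GRing.isLinear.Build R L R^o *:%R (co k : L -> R^o) (co_linear k).

Definition kerco k : {vspace L} := lker (linfun (co k : L -> R^o)).

Lemma mem_kerco k x : (x \in kerco k) = (co k x == 0).
Proof. by rewrite memv_ker lfunE. Qed.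

(** The span of f_1, ..., f_5, which [nilradicalE] shows to be the nilradical. *)
Let N := kerco 6.

Lemma kerco6_ideal : is_ideal N.
Proof. by apply/idealP => x y _; rewrite mem_kerco co6_lie. Qed.

Lemma kerco6_lcs1 x : x \in lcs N 1 ->
  [/\ co 2 x = 0, co 3 x = 0, co 4 x = 0, co 5 x = 0 & co 6 x = 0].
Proof.
have : (lcs N 1 <= \bigcap_(i < 5) kerco i.+2)%VS.
  apply/brs_subP => u v; rewrite !mem_kerco => /eqP u6 /eqP v6.
  apply/subv_bigcapP => -[[|[|[|[|[|//]]]]] ?] _;
  by rewrite -memvE mem_kerco /= colieE ?u6 ?v6 ?mulr0 ?mul0r ?subr0 ?oppr0.
move=> /subvP s /s {s}; rewrite memvE => /subv_bigcapP s.
have {}s (i : 'I_5) : co i.+2 x = 0 by have := s i isT; rewrite -memvE mem_kerco => /eqP.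
by split; [exact: (s 0)|exact: (s (@Ordinal 5 1 isT))|exact: (s (@Ordinal 5 2 isT))
  |exact: (s (@Ordinal 5 3 isT))|exact: (s (@Ordinal 5 4 isT))].
Qed.

Lemma kerco6_nilpotent : nilpotent_sub N.
Proof.
exists 2%N; apply/eqP; rewrite -subv0; apply/brs_subP => x y.
rewrite mem_kerco memv0 => /eqP x6 /kerco6_lcs1[y2 y3 y4 y5 y6].
by apply/eqP/co_ext; rewrite ?colieE coE ?x6 ?y2 ?y3 ?y4 ?y5 ?y6; ring.
Qed.

(* On the span of f_2, f_3, [ad w] is, modulo f_1, the rotation generator
   scaled by the f_6-coordinate of w, so it is not nilpotent unless the latter
   vanishes. *)
Lemma nilpotent_ideal_sub (I : {vspace L}) :
  is_ideal I -> nilpotent_sub I -> (I <= N)%VS.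
Proof.
move=> /idealP idI [l Il0]; apply/subvP => w wI; rewrite mem_kerco.
apply: contraT => w6.
have rot v : co 6 v = 0 ->
    co 2 (lie w v) ^+ 2 + co 3 (lie w v) ^+ 2
    = co 6 w ^+ 2 * (co 2 v ^+ 2 + co 3 v ^+ 2).
  by move=> v6; rewrite !colieE v6; ring.
have nz v : co 6 v = 0 -> co 2 v ^+ 2 + co 3 v ^+ 2 != 0 ->
    co 2 (lie w v) ^+ 2 + co 3 (lie w v) ^+ 2 != 0.
  by move=> v6 v23; rewrite rot // mulf_neq0 // expf_neq0.
(* Applying [ad w] repeatedly to [lie w f2], which lies in the ideal, never kills the f_2, f_3 part,
   so every term of the series of [I] is nonzero. *)
have [v [vI v6 v23]] : exists v, [/\ v \in lcs I l, co 6 v = 0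
    & co 2 v ^+ 2 + co 3 v ^+ 2 != 0].
  elim: l {Il0} => [|l [v [vI v6 v23]]].
    pose f2 := vec 0 1 0 0 0 0; exists (lie w f2).
    split; first by rewrite lieC memvN; exact: idI.
      exact: co6_lie.
    by apply: nz; rewrite ?co_vec //= expr1n expr0n addr0 oner_eq0.
  exists (lie w v); split; [exact: mem_brs|exact: co6_lie|exact: nz].
by move: vI v23; rewrite Il0 memv0 => /eqP->; rewrite !co0 expr0n addr0 eqxx.
Qed.

(** [N] is a nilpotent ideal containing every nilpotent ideal, hence the only maximal one. *)
Lemma nilradicalE (n : {vspace L}) : is_nilradical n -> n = N.
Proof.
case=> idn niln maxn; apply/esym/maxn; [exact: kerco6_ideal|exact: kerco6_nilpotent|].
exact: nilpotent_ideal_sub.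
Qed.

Section Balanced.
Variables (J : 'End(L)) (g : {dot L for idfun}).
(** [J] and [g] are only required to match [J_ex] and [g_ex] through [phi]. This covers both the
    structure pulled back to [L] and, with [phi] the identity, the example itself. *)
Hypothesis JE : forall x, phi (J x) = J_ex R (phi x).
Hypothesis gE : forall x y, g x y = g_ex (phi x) (phi y).

Lemma co_J x :
  [/\ co 1 (J x) = co 5 x, co 2 (J x) = - co 3 x, co 3 (J x) = co 2 x
    & [/\ co 4 (J x) = co 6 x, co 5 (J x) = - co 1 x & co 6 (J x) = - co 4 x]].
Proof.
rewrite /co JE J_exE /J_fun /fd /fb !mxE !eqxx /=.
have e i j : (i < 6)%N -> (j < 6)%N -> ((inord i : 'I_6) == inord j) = (i == j).
  by move=> i6 j6; rewrite -val_eqE /= !inordK.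
by rewrite !e //= !mulr0n !mulr1n; split; [ring|ring|ring|split; ring].
Qed.

Lemma g_co x y : g x y = co 1 x * co 1 y + co 2 x * co 2 y + co 3 x * co 3 y
  + co 4 x * co 4 y + co 5 x * co 5 y + co 6 x * co 6 y.
Proof.
rewrite gE /g_ex.
under eq_bigr => k _ do
  rewrite -[phi x 0 k]/(phi x 0 k) -{1 2}(inord_val k) -!/(fd k.+1 _) -!/(co k.+1 _).
by rewrite !big_ord_recl big_ord0 addr0 !addrA.
Qed.

(** The f_6-coordinate of [J x] is minus the f_4-coordinate of [x], and brackets in [N] have no f_4
    component. *)
Lemma J_lcs1 n : is_nilradical n -> (J @: lcs n 1 <= n)%VS.
Proof.
move=> /nilradicalE->; apply/subvP => _ /memv_imgP[x xN ->].
case: (kerco6_lcs1 xN) => _ _ x4 _ _.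
by rewrite mem_kerco; case: (co_J x) => _ _ _ [_ _ ->]; rewrite x4 oppr0.
Qed.

Lemma s516_hermitian : hermitian_structure J g.
Proof.
have JE1 x : co 1 (J x) = co 5 x by case: (co_J x).
have JE2 x : co 2 (J x) = - co 3 x by case: (co_J x).
have JE3 x : co 3 (J x) = co 2 x by case: (co_J x).
have JE4 x : co 4 (J x) = co 6 x by case: (co_J x) => ? ? ? [].
have JE5 x : co 5 (J x) = - co 1 x by case: (co_J x) => ? ? ? [].
have JE6 x : co 6 (J x) = - co 4 x by case: (co_J x) => ? ? ? [].
have JEE := (JE1, JE2, JE3, JE4, JE5, JE6).
split; first split.
- by move=> x; apply: co_ext; rewrite !(coE, JEE); ring.
- by move=> x y; apply: co_ext; rewrite !(coE, JEE, colieE); ring.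
- by move=> x y; rewrite !g_co !JEE; ring.
Qed.

(** Here omega = - f^15 + f^23 - f^46 and the exponent 6/2 - 1 is 2. On five arbitrary vectors,
    d(omega^2) = 0 is a polynomial identity in their coordinates. *)
Lemma s516_balanced : \dim {:L} = 6%N -> balanced J g.
Proof.
move=> dimL; split; first exact: s516_hermitian.
rewrite dimL /= => x.
pose b u v := g (J u) v.
have bE u v : b u v = co 5 u * co 1 v - co 3 u * co 2 v + co 2 u * co 3 v
    + co 6 u * co 4 v - co 1 u * co 5 v - co 4 u * co 6 v.
  by rewrite /b g_co; case: (co_J u) => -> -> -> [-> -> ->]; ring.
have bC u v : b u v = - b v u by rewrite !bE; ring.
pose X k := x (inord k).
have -> : x = (fun i => X i).
  by apply: functional_extensionality => i; rewrite /X inord_val.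
rewrite (ce_d_sq X bC) /ce_sum4 /form_sq !bE !colieE.
ring.
Qed.

End Balanced.

Definition pull_dot (x y : L) : R := g_ex (phi x) (phi y).

Fact pull_dot_bilinear : bilinear_for *%R *%R pull_dot.
Proof.
by split=> z a x y; rewrite /pull_dot linearP /= ?linearPl ?linearPr.
Qed.

HB.instance Definition _ :=
  bilinear_isBilinear.Build R L L R *%R *%R pull_dot pull_dot_bilinear.

Fact pull_dot_sym x y : pull_dot x y = (-1) ^+ false * idfun (pull_dot y x).
Proof. exact: g_ex_sym. Qed.

HB.instance Definition _ :=
  isHermitianSesquilinear.Build R L false idfun pull_dot pull_dot_sym.

Fact pull_dot_gt0 x : x != 0 -> 0 < pull_dot x x.
Proof.
move=> nzx; apply: g_ex_gt0; apply: contra nzx => /eqP phix0.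
by rewrite -memv0 -phi_inj memv_ker phix0.
Qed.

HB.instance Definition _ := isDotProduct.Build R L pull_dot pull_dot_gt0.

Definition pull_J : 'End(L) := (phi^-1 \o J_ex R \o phi)%VF.

Lemma pull_JE x : phi (pull_J x) = J_ex R (phi x).
Proof. by rewrite !lfunE /= lfunE /= limg_lfunVK ?phi_surj ?memvf. Qed.

Lemma ex_balanced (n : {vspace L}) : \dim {:L} = 6%N -> is_nilradical n ->
  exists (J : 'End(L)) (g : {dot L for idfun}),
    balanced J g /\ (J @: lcs n 1 <= n)%VS.
Proof.
move=> dimL nil_n; exists pull_J, (pull_dot : {dot L for idfun}); split.
  by apply: s516_balanced => //; apply: pull_JE.
by apply: J_lcs1 => //; apply: pull_JE.
Qed.

Lemma not_kaehler : ~ exists (J : 'End(L)) (g : {dot L for idfun}), kaehler J g.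
Proof.
case=> J [g [[[JJ NJ] gJ] cl]].
have gC u v : g u v = g v u by rewrite hermC expr0 mul1r.
have gJr u v : g (J u) v = - g u (J v).
  by rewrite -[in LHS](gJ (J u)) JJ linearNl.
(* The equation d omega (u, v, w) = 0, solved for one of its three terms. *)
have dw u v w :
    g (J (lie u v)) w = g (J (lie u w)) v - g (J (lie v w)) u.
  have := cl (fun i => [:: u; v; w]`_i).
  rewrite (ce_d2 (fun u v => g (J u) v) (fun k => [:: u; v; w]`_k)) /=.
  move=> e; lra.
pose z := vec 1 0 0 0 0 0; pose y := J z.
have z_central w : lie z w = 0.
  by apply: co_ext; rewrite ?colieE ?co_vec // co0 /=; ring.
have z_ne0 : z != 0.
  by apply/eqP => /(congr1 (co 1)); rewrite co_vec // co0 => /eqP; rewrite oner_eq0.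
(* Since [z] is central, a single term of d omega (z, u, v) survives. *)
have gy u v : g (lie u v) y = 0.
  have := dw z u v; rewrite !z_central linear0 !linear0l sub0r gJr => /esym/eqP.
  by rewrite opprK => /eqP.
have DJ w : lie y (J w) = J (lie y w).
  have := NJ z w; rewrite !z_central -/y linear0 !subr0 => /eqP.
  by rewrite subr_eq0 => /eqP.
(* If [y, w] = k z, then [y, J w] = k y; as [y] is orthogonal to all brackets, k g(y, y) = 0. *)
have Dz w k : lie y w = k *: z -> k = 0.
  move=> Dw; have := gy y (J w); rewrite DJ Dw linearZ linearZl_LR /= => /eqP.
  rewrite mulf_eq0 => /orP[/eqP//|/eqP gyy].
  by have := gJ z z; rewrite -/y gyy => /esym/eqP; rewrite gt_eqF // neq0_dnorm_gt0.
(* [Dz] is applied to f_4, f_2, f_3, f_6 in this order. The coordinates already known to vanish make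
   each bracket with [y] a multiple of z = f_1, whose coefficient is, up to sign, the next
   coordinate of [y]. *)
have y6 : co 6 y = 0.
  apply: (Dz (vec 0 0 0 1 0 0)).
  by apply: co_ext; rewrite ?colieE coZ ?co_vec //=; ring.
have y3 : co 3 y = 0.
  apply: (Dz (vec 0 1 0 0 0 0)).
  by apply: co_ext; rewrite ?colieE coZ ?co_vec //= ?y6; ring.
have y2 : co 2 y = 0.
  apply/eqP; rewrite -oppr_eq0; apply/eqP; apply: (Dz (vec 0 0 1 0 0 0)).
  by apply: co_ext; rewrite ?colieE coZ ?co_vec //= ?y6; ring.
have y4 : co 4 y = 0.
  apply/eqP; rewrite -oppr_eq0; apply/eqP; apply: (Dz (vec 0 0 0 0 0 1)).
  by apply: co_ext; rewrite ?colieE coZ ?co_vec //= ?y2 ?y3; ring.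
have D0 w : lie y w = 0.
  by apply: co_ext; rewrite ?colieE co0 ?y2 ?y3 ?y4 ?y6; ring.
(* With [ad y] zero, d omega (y, u, v) = 0 says that [u, v] is orthogonal to J y = - z; but
   [f_3, f_2] = z. *)
have gz u v : g (lie u v) z = 0.
  have := dw y u v; rewrite !D0 linear0 !linear0l sub0r gJr /y JJ.
  by rewrite linearNr !opprK => /esym/eqP; rewrite oppr_eq0 => /eqP.
have : g z z = 0.
  rewrite -{1}(_ : lie (vec 0 0 1 0 0 0) (vec 0 1 0 0 0 0) = z) ?gz //.
  by apply: co_ext; rewrite ?colieE ?co_vec //=; ring.
by move/eqP; rewrite gt_eqF // neq0_dnorm_gt0.
Qed.

(** f_5 is central and occurs in no bracket, so its line and the kernel of f^5 are complementary
    ideals. *)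
Lemma s516_decomposable : decomposable L.
Proof.
pose f5 := vec 0 0 0 0 1 0.
have f5_ne0 : f5 != 0.
  by apply/eqP => /(congr1 (co 5)); rewrite co_vec // co0 => /eqP; rewrite oner_eq0.
have f1_ne0 : vec 1 0 0 0 0 0 != 0.
  by apply/eqP => /(congr1 (co 1)); rewrite co_vec // co0 => /eqP; rewrite oner_eq0.
exists <[f5]>%VS, (kerco 5); split.
- split; apply/idealP => x y.
    case/vlineP => k ->; rewrite lieZr (_ : lie x f5 = 0) ?scaler0 ?mem0v //.
    by apply: co_ext; rewrite ?colieE ?co0 ?co_vec //=; ring.
  by rewrite !mem_kerco colieE.
- by move=> e; move: f5_ne0; rewrite -memv0 -e memv_line.
- move=> e; move: f1_ne0; rewrite -memv0 -e mem_kerco co_vec //= eqxx //.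
- apply/vspaceP => x; rewrite memvf.
  rewrite -[x](subrK (co 5 x *: f5)) addrC memv_add ?memvZ ?memv_line //.
  by rewrite mem_kerco !coE co_vec //= mulr1 subrr.
- apply/eqP; rewrite -subv0; apply/subvP => x; rewrite memv_cap mem_kerco memv0.
  case/andP => /vlineP[k ->]; rewrite coZ co_vec //= mulr1 => /eqP->.
  by rewrite scale0r.
Qed.

Lemma s516_step_solvable : step_solvable L 3.
Proof.
have D1 : (dseries L 1 <= kerco 4 :&: kerco 6)%VS.
  by apply/brs_subP => x y _ _; rewrite memv_cap !mem_kerco !colieE eqxx.
have D2 : (dseries L 2 <= kerco 2 :&: kerco 3 :&: (kerco 4 :&: kerco 6))%VS.
  apply/brs_subP => x y /(subvP D1) + /(subvP D1).
  rewrite !memv_cap !mem_kerco => /andP[_ /eqP x6] /andP[_ /eqP y6].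
  by rewrite !colieE x6 y6 !(mulr0, mul0r, subr0, oppr0) eqxx.
split=> [|j j3 Dj0].
  apply/eqP; rewrite -subv0.
  apply/brs_subP => x y /(subvP D2) + /(subvP D2).
  rewrite !memv_cap !mem_kerco => /andP[/andP[/eqP x2 /eqP x3] /andP[/eqP x4 /eqP x6]].
  move=> /andP[/andP[/eqP y2 /eqP y3] /andP[/eqP y4 /eqP y6]].
  rewrite memv0; apply/eqP/co_ext; rewrite ?colieE co0 ?x2 ?x3 ?x4 ?x6; ring.
pose f1 := vec 1 0 0 0 0 0; pose f2 := vec 0 1 0 0 0 0.
pose f3 := vec 0 0 1 0 0 0; pose f6 := vec 0 0 0 0 0 1.
have f32 : lie f3 f2 = f1 by apply: co_ext; rewrite ?colieE ?co_vec //=; ring.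
have f63 : lie f6 f3 = f2 by apply: co_ext; rewrite ?colieE ?co_vec //=; ring.
have f26 : lie f2 f6 = f3 by apply: co_ext; rewrite ?colieE ?co_vec //=; ring.
(* f_1 = [f_3, f_2], and f_2 and f_3 are themselves brackets, so f_1 survives in the second derived
   algebra. *)
have : f1 \in dseries L j.
  case: j j3 {Dj0} => [|[|[|//]]] _; first exact: memvf.
    by rewrite -f32; apply: mem_brs; apply: memvf.
  rewrite -f32; apply: mem_brs.
    by rewrite -f26; apply: mem_brs; apply: memvf.
  by rewrite -f63; apply: mem_brs; apply: memvf.
rewrite Dj0 memv0 => /eqP/(congr1 (co 1)); rewrite co_vec // co0 => /eqP.
by rewrite oner_eq0.
Qed.

(** With k the f_6-coordinate of [x], (ad x)^4 = - k^2 (ad x)^2, so an eigenvalue z satisfies z^2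
    (z^2 + k^2) = 0. *)
Lemma s516_type_I : type_I L.
Proof.
move=> x z e /eigenvalueP[v vM nzv].
have be : basis_of {:L} e := vbasisP _.
pose A := ad x; pose k := co 6 x.
have A4 : (A \o (A \o (A \o A)))%VF = (- k ^+ 2) *: (A \o A)%VF.
  apply/lfunP => w; rewrite !lfunE /= !lfunE /= !lfunE /= !lfunE /=.
  by rewrite /k; apply: co_ext; rewrite coZ !colieE; ring.
pose M := passmx.mxof e e A; pose C : 'M[R[i]]_(_) := map_mx (real_complex R) M.
have M4 : M *m M *m M *m M = (- k ^+ 2) *: (M *m M).
  rewrite -!(passmx.mxof_comp e e be) A4.
  exact: (GRing.scalable_linear (passmx.mxof_linear e e)).
have C4 : C *m C *m C *m C = (- (real_complex R k) ^+ 2) *: (C *m C).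
  by rewrite -!map_mxM M4 map_mxZ rmorphN rmorphXn.
have {}vM : v *m C = z *: v by [].
have v2 : v *m (C *m C) = z ^+ 2 *: v.
  by rewrite mulmxA vM -scalemxAl vM scalerA.
have : v *m (C *m C *m C *m C) = z ^+ 4 *: v.
  rewrite -!mulmxA [C *m (C *m C)]mulmxA !mulmxA.
  rewrite vM -!scalemxAl vM -!scalemxAl vM -!scalemxAl vM !scalerA.
  by rewrite !exprS expr0 mulr1 !mulrA.
rewrite C4 -scalemxAr v2 scalerA => /eqP.
rewrite -subr_eq0 -scalerBl scaler_eq0 (negPf nzv) orbF.
rewrite (_ : _ - _ = - (z ^+ 2 * (real_complex R k ^+ 2 + z ^+ 2))); last by ring.
rewrite oppr_eq0 mulf_eq0 expf_eq0 /= => /orP[/eqP->//|].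
(* For z = a + i b, the imaginary part of z^2 + k^2 = 0 gives a b = 0; if b = 0, the real part reads
   a^2 = - k^2 and forces a = 0. *)
case: z {vM v2} => a b; rewrite !expr2 /= => /eqP[re0 im0].
have /eqP : a * b = 0 by lra.
rewrite mulf_eq0 => /orP[/eqP//|/eqP b0]; apply/eqP.
rewrite -sqrf_eq0 eq_le sqr_ge0 andbT expr2; move: re0; rewrite b0.
by have := sqr_ge0 k; rewrite expr2; lra.
Qed.

(** On the kernel of f^6 only df^1 = f^23 survives, so the basis of h_3 goes to f_2, f_3, f_1 and
    that of R^2 to f_4, f_5. *)
Definition h3_emb (p : h3 R * abelian_lie R 2) : L :=
  vec (fd 3 (p.1 : 'rV_3)) (fd 1 (p.1 : 'rV_3)) (fd 2 (p.1 : 'rV_3))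
    (fd 1 (p.2 : 'rV_2)) (fd 2 (p.2 : 'rV_2)) 0.

Fact h3_emb_linear : linear h3_emb.
Proof.
move=> a p q; apply: co_ext; rewrite coD coZ !co_vec //= /fd ?mxE //.
by rewrite mulr0 addr0.
Qed.

HB.instance Definition _ :=
  GRing.isLinear.Build R (h3 R * abelian_lie R 2)%type L *:%R h3_emb h3_emb_linear.

Lemma s516_nilradical (n : {vspace L}) :
  is_nilradical n -> isog_sub (h3 R * abelian_lie R 2)%type n.
Proof.
move/nilradicalE => ->.
exists (linfun h3_emb); split.
- apply/eqP/lker0P => p q; rewrite !lfunE /= => epq.
  have e k : co k (h3_emb p) = co k (h3_emb q) by rewrite epq.
  have := (e 1%N, e 2%N, e 3%N, e 4%N, e 5%N).
  rewrite !co_vec //= => -[[[[e1 e2] e3] e4] e5].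
  case: p q e1 e2 e3 e4 e5 {epq e} => p1 p2 [q1 q2] /= e1 e2 e3 e4 e5.
  congr pair; apply/rowP => i; rewrite -(inord_val i).
    by case: i => -[|[|[|//]]] ? /=.
  by case: i => -[|[|//]] ? /=.
- apply/vspaceP => x; apply/memv_imgP/idP => [[p _ ->]|].
    by rewrite lfunE mem_kerco co_vec.
  rewrite mem_kerco => /eqP x6.
  exists ((\row_i [:: co 2 x; co 3 x; co 1 x]`_i, \row_i [:: co 4 x; co 5 x]`_i)
     : h3 R * abelian_lie R 2); first exact: memvf.
  by rewrite lfunE /=; apply: co_ext; rewrite co_vec //= /fd mxE inordK.
- move=> p q; rewrite !lfunE /=; apply: co_ext; rewrite ?colieE !co_vec //=;
    rewrite ?mulr0 ?mul0r ?subrr ?oppr0 //.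
  all: rewrite /fd !mxE ?inordK //= /fw /fd /=; ring.
Qed.

End S516Coordinates.

(** * Centrality of the commutator line *)

Lemma vspace_dim1 (K : fieldType) (V : vectType K) (U : {vspace V}) (z : V) :
  \dim U = 1%N -> z \in U -> z != 0 -> U = <[z]>%VS.
Proof.
move=> dU zU nz; apply/esym/eqP; rewrite eqEdim dU dim_vline nz andbT.
by apply/subvP => _ /vlineP[k ->]; apply: memvZ.
Qed.

(** Were n^2 nonzero, it would equal the line n^1 and the series would never reach 0. So n^1/n^2 is
    n^1 itself, on which [ad x] acts by a scalar equal to its trace. *)
Lemma lcs1_central (K : fieldType) (L : lieAlgType K) (n : {vspace L}) :
  is_ideal n -> nilpotent_sub n -> strongly_unimodular n ->
  \dim (lcs n 1) = 1%N -> forall x z, z \in lcs n 1 -> lie x z = 0.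
Proof.
move=> idn [l nill] um d1 x z zn.
have n2 : lcs n 2 = 0%VS.
  apply/eqP; rewrite -dimv_eq0; apply: contraT => d2.
  have e : lcs n 2 = lcs n 1.
    by apply/eqP; rewrite eqEdim lcs_sub // d1 lt0n.
  have := lcs_eq0 nill (leq_addr 1 l); rewrite lcs_stat // => /eqP.
  by rewrite -dimv_eq0 d1.
have [->|nz] := eqVneq z 0; first by rewrite lie0r.
have idn1 : is_ideal (lcs n 1) by apply: ideal_brs.
have xz : lie x z \in lcs n 1 by apply: (idealP _ idn1).
have := um x 1%N; rewrite n2 (vspace_dim1 d1 zn nz).
move: xz; rewrite (vspace_dim1 d1 zn nz) => /vlineP[a xz].
rewrite (@quot_trace_eq _ _ 1 [tuple z] _ _ _ a%:M).
- by rewrite mxtrace_scalar mulr1n => a0; rewrite xz a0 scale0r.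
- exact: sub0v.
- apply/subvP => _ /memv_imgP[_ /vlineP[k ->] ->].
  by rewrite lfunE /= lieZr xz !memvZ ?memv_line.
- by rewrite limg0.
- by rewrite addv0 span_seq1.
- by rewrite dimv0 dim_vline nz.
- by move=> i; rewrite big_ord1 !ord1 mxE eqxx mulr1n /= lfunE /= xz subrr mem0v.
Qed.

(** * Unit vectors and orthonormal bases *)

Section Euclidean.
Context {R : realType} {L : lieAlgType R} (g : {dot L for idfun}).
Implicit Types w : L.

Lemma dotC a b : g a b = g b a.
Proof. by rewrite hermC expr0 mul1r. Qed.

Lemma dotDl a b c : g (a + b) c = g a c + g b c.
Proof. exact: linearDl. Qed.

Lemma dotZl k a c : g (k *: a) c = k * g a c.
Proof. exact: linearZl_LR. Qed.

Lemma dotNl a c : g (- a) c = - g a c.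
Proof. exact: linearNl. Qed.

Lemma dotNr a c : g c (- a) = - g c a.
Proof. exact: linearNr. Qed.

Lemma dot0l c : g 0 c = 0.
Proof. exact: linear0l. Qed.

Definition dotE := (dotDl, dotZl, dotNl, dot0l).

Definition dot_row k (X : k.-tuple L) w : 'rV[R]_k := \row_i g w X`_i.

Fact dot_row_linear k (X : k.-tuple L) : linear (dot_row X).
Proof. by move=> a v w; apply/rowP => i; rewrite !mxE dotDl dotZl. Qed.

HB.instance Definition _ k (X : k.-tuple L) :=
  GRing.isLinear.Build R L 'rV[R]_k *:%R (dot_row X) (dot_row_linear X).

Lemma exists_unit (U : {vspace L}) : U != 0%VS -> exists2 w, w \in U & g w w = 1.
Proof.
rewrite -vpick0; set w := vpick _ => nzw.
have gw : 0 < g w w by apply: neq0_dnorm_gt0.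
have sw : Num.sqrt (g w w) != 0 by rewrite sqrtr_eq0 -ltNge.
exists ((Num.sqrt (g w w))^-1 *: w); first by apply/memvZ/memv_pick.
rewrite dotZl dotC dotZl -{3}(sqr_sqrtr (ltW gw)).
by field.
Qed.

(** The orthogonality conditions define the kernel of a linear map to R^k, which is nonzero when k
    is less than the dimension. *)
Lemma exists_unit_orth k (X : k.-tuple L) : (k < \dim {:L})%N ->
  exists2 w, g w w = 1 & forall i : 'I_k, g w X`_i = 0.
Proof.
move=> kL; pose f := linfun (dot_row X).
have /exists_unit[w wf gw] : lker f != 0%VS.
  rewrite -dimv_eq0 -lt0n; have := limg_ker_dim f fullv.
  rewrite capfv => dE; rewrite -(ltn_add2r (\dim (limg f))) dE add0n.
  apply: leq_ltn_trans kL; apply: leq_trans (dimvS (subvf _)) _.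
  by rewrite dimvf dim_matrix mul1r.
exists w => // i; move: wf; rewrite memv_ker lfunE /= => /eqP/rowP/(_ i).
by rewrite !mxE.
Qed.

Lemma orthonormal_expand k (X : k.-tuple L) : k = \dim {:L} ->
  (forall i j : 'I_k, g X`_i X`_j = (i == j)%:R) ->
  forall w, w = \sum_(i < k) g w X`_i *: X`_i.
Proof.
move=> kL oX w.
have frX : free X.
  apply/freeP => c c0 i; have := congr1 (g^~ X`_i) c0.
  rewrite /= linear0l linear_sumlz (bigD1 i) //= big1 ?addr0 => [|j ji].
    by rewrite dotZl oX eqxx mulr1.
  by rewrite dotZl oX (negPf ji) mulr0.
have bX : basis_of {:L} X by rewrite basisEfree frX subvf size_tuple kL leqnn.
rewrite {1}(coord_basis bX (memvf w)); apply: eq_bigr => i _; congr (_ *: _).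
rewrite [in RHS](coord_basis bX (memvf w)) linear_sumlz (bigD1 i) //=.
rewrite big1 ?addr0 => [|j ji].
  by rewrite dotZl oX eqxx mulr1.
by rewrite dotZl oX (negPf ji) mulr0.
Qed.

End Euclidean.

(** * Structure constants in a unitary frame adapted to the nilradical *)

Section AdaptedFrame.
Context {R : realType} {L : lieAlgType R}.
Variables (n : {vspace L}) (J : 'End(L)) (g : {dot L for idfun}) (b : nat -> L).
Local Notation e := (b 0%N).
Local Notation x := (b 1%N).
Local Notation z := (b 2%N).
Local Notation y := (b 3%N).
Local Notation u := (b 4%N).
Local Notation v := (b 5%N).
Hypothesis herm : hermitian_structure J g.
Hypothesis dimL : \dim {:L} = 6%N.
Hypothesis dim_n : \dim n = 5%N.
Hypothesis b_orth :
  forall i j, (i < 6)%N -> (j < 6)%N -> g (b i) (b j) = (i == j)%:R.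
Hypothesis Jb : [/\ J e = x, J z = y & J u = v].
Hypothesis mem_n : forall w, (w \in n) = (g w x == 0).
Hypothesis n_ideal : is_ideal n.
Hypothesis n1E : lcs n 1 = <[z]>%VS.
Hypothesis z_central : forall w, lie w z = 0.

Lemma frame_expand w : w = \sum_(i < 6) g w (b i) *: b i.
Proof.
have s6 : size (mkseq b 6) == \dim {:L} by rewrite size_mkseq dimL.
pose X : 6.-tuple L := [tuple of mkseq b 6].
have XE (i : 'I_6) : X`_i = b i by rewrite nth_mkseq.
have := @orthonormal_expand _ _ g 6 X (esym dimL) _ w.
under eq_bigr do rewrite XE; apply=> i j.
by rewrite !XE b_orth.
Qed.

Lemma frame_ext w w' : (forall i, (i < 6)%N -> g w (b i) = g w' (b i)) -> w = w'.
Proof.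
move=> ww'; rewrite (frame_expand w) (frame_expand w').
by apply: eq_bigr => i _; rewrite ww'.
Qed.

Fact JK w : J (J w) = - w. Proof. by case: herm => -[]. Qed.
Fact JD w w' : J (w + w') = J w + J w'. Proof. exact: linearD. Qed.
Fact JN w : J (- w) = - J w. Proof. exact: linearN. Qed.
Fact JZ k w : J (k *: w) = k *: J w. Proof. exact: linearZ. Qed.
Fact J0 : J 0 = 0. Proof. exact: linear0. Qed.
Fact Je : J e = x. Proof. by case: Jb. Qed.
Fact Jz : J z = y. Proof. by case: Jb. Qed.
Fact Ju : J u = v. Proof. by case: Jb. Qed.
Fact Jx : J x = - e. Proof. by rewrite -Je JK. Qed.
Fact Jy : J y = - z. Proof. by rewrite -Jz JK. Qed.
Fact Jv : J v = - u. Proof. by rewrite -Ju JK. Qed.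

Let JE := (JD, JN, JZ, J0, Je, Jz, Ju, Jx, Jy, Jv).
Lemma frame_mem i : (i < 6)%N -> i != 1%N -> b i \in n.
Proof. by move=> i6 i1; rewrite mem_n b_orth // (negPf i1). Qed.

Lemma frame_neq0 i : (i < 6)%N -> b i != 0.
Proof.
move=> i6; apply/eqP => bi0; have := b_orth i6 i6.
by rewrite bi0 dot0l eqxx => /esym/eqP; rewrite oner_eq0.
Qed.

Lemma lie_n w w' : w \in n -> w' \in n -> lie w w' = g (lie w w') z *: z.
Proof.
move=> wn w'n; have : lie w w' \in lcs n 1 by apply: mem_brs.
by rewrite n1E => /vlineP[k ->]; rewrite dotZl b_orth // mulr1.
Qed.

Lemma z_centralr w : lie z w = 0.
Proof. by rewrite lieC z_central oppr0. Qed.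

Lemma Nijenhuis w w' :
  lie (J w) (J w') - J (lie (J w) w') - J (lie w (J w')) - lie w w' = 0.
Proof. by case: herm => -[]. Qed.

(** Because [z] is central, the Nijenhuis identity at [z], [w] keeps only the two terms with y = J
    z. *)
Lemma ad_y_J w : lie y (J w) = J (lie y w).
Proof.
have := Nijenhuis z w; rewrite Jz !z_centralr J0 !subr0 => /eqP.
by rewrite subr_eq0 => /eqP.
Qed.

(** Brackets inside n are multiples of [z], so one constant describes each. Those of [x] with [u]
    and [e] need several; those with [y] and [v] follow by integrability. *)
Let c := g (lie y e) z.
Let a := g (lie u v) z.
Let p := g (lie e u) z.
Let q := g (lie e v) z.
Let p1 := g (lie x u) z.
Let p2 := g (lie x u) y.
Let m := g (lie x u) u.
Let t := g (lie x u) v.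
Let al := g (lie x e) e.
Let b1 := g (lie x e) z.
Let b2 := g (lie x e) y.
Let b3 := g (lie x e) u.
Let b4 := g (lie x e) v.

Lemma lie_ye : lie y e = c *: z. Proof. by apply: lie_n; apply: frame_mem. Qed.
Lemma lie_uv : lie u v = a *: z. Proof. by apply: lie_n; apply: frame_mem. Qed.
Lemma lie_eu : lie e u = p *: z. Proof. by apply: lie_n; apply: frame_mem. Qed.
Lemma lie_ev : lie e v = q *: z. Proof. by apply: lie_n; apply: frame_mem. Qed.

Lemma lie_yx : lie y x = c *: y.
Proof. by rewrite -Je ad_y_J lie_ye JZ Jz. Qed.

(** Both brackets are multiples of [z], yet [y, v] = J [y, u] is a multiple of [y]. *)
Lemma lie_yu_yv : lie y u = 0 /\ lie y v = 0.
Proof.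
have yu : lie y u = g (lie y u) z *: z by apply: lie_n; apply: frame_mem.
have yv : lie y v = g (lie y v) z *: z by apply: lie_n; apply: frame_mem.
have yvE : lie y v = g (lie y u) z *: y by rewrite -Ju ad_y_J yu JZ Jz -yu.
have yu0 : g (lie y u) z = 0.
  have := congr1 (g^~ y) yvE; rewrite yv /= !dotZl !b_orth //=.
  by rewrite mulr0 mulr1.
by split; [rewrite yu yu0 scale0r|rewrite yvE yu0 scale0r].
Qed.

Lemma lie_yu : lie y u = 0. Proof. by case: lie_yu_yv. Qed.
Lemma lie_yv : lie y v = 0. Proof. by case: lie_yu_yv. Qed.

Lemma lie_xn w : w \in n -> g (lie x w) x = 0.
Proof. by move=> wn; apply/eqP; rewrite -mem_n; apply: (idealP _ n_ideal). Qed.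

(** This is the Nijenhuis identity at [e], [u]. *)
Lemma lie_xvE : lie x v = J (lie x u) + q *: y + p *: z.
Proof.
have := Nijenhuis e u; rewrite Je Ju lie_eu lie_ev JZ Jz => /eqP.
by rewrite !subr_eq add0r => /eqP->; rewrite addrC addrA addrAC -addrA addrC.
Qed.

Lemma lie_xu : lie x u = p1 *: z + p2 *: y + m *: u + t *: v.
Proof.
have x0 : g (lie x u) x = 0 by apply/lie_xn/frame_mem.
(* [J] turns an e component of [x, u] into an x component of [x, v], which is absent because [x, v]
   lies in n. *)
have e0 : g (lie x u) e = 0.
  have : g (lie x v) x = 0 by apply/lie_xn/frame_mem.
  rewrite lie_xvE !dotE !b_orth //= !mulr0 !addr0 -Je.
  by case: herm => _ ->.
rewrite [LHS]frame_expand !big_ord_recl big_ord0 /bump /= x0 e0 !scale0r !add0r addr0.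
by rewrite !addrA.
Qed.

Lemma lie_xv : lie x v = (p - p2) *: z + (p1 + q) *: y + m *: v - t *: u.
Proof.
rewrite lie_xvE lie_xu !JE.
apply: frame_ext => -[|[|[|[|[|[|//]]]]]] _; rewrite !dotE !b_orth //=; ring.
Qed.

Lemma lie_xe : lie x e = al *: e + b1 *: z + b2 *: y + b3 *: u + b4 *: v.
Proof.
have x0 : g (lie x e) x = 0 by apply/lie_xn/frame_mem.
rewrite [LHS]frame_expand !big_ord_recl big_ord0 /bump /= x0 scale0r add0r addr0.
by rewrite !addrA.
Qed.

Lemma lie_ex : lie e x = - (al *: e + b1 *: z + b2 *: y + b3 *: u + b4 *: v).
Proof. by rewrite lieC lie_xe. Qed.
Lemma lie_ey : lie e y = - (c *: z). Proof. by rewrite lieC lie_ye. Qed.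
Lemma lie_xy : lie x y = - (c *: y). Proof. by rewrite lieC lie_yx. Qed.

Let tab := (z_central, z_centralr, lie_ye, lie_yx, lie_ey, lie_xy, lie_yu, lie_yv,
  lie_eu, lie_ev, lie_xu, lie_xv, lie_uv, lie_xe, lie_ex).

Section Consequences.
Hypothesis coclosed : closed_form (wedge_pow (fundamental_form J g) 2).
Hypothesis trace0 : forall w, quot_trace (ad w) n <[z]>%VS = 0.

Lemma coclosed_eval (X : nat -> L) :
  ce_sum4 (form_sq (fun w w' => g (J w) w')) X = 0.
Proof.
rewrite -(ce_d_sq X); first exact: coclosed.
case: herm => _ gJ w w'.
by rewrite -gJ JK dotNl dotC.
Qed.

(** Each equation is d(omega^2) = 0 on five frame vectors, leaving out [e], [z], [y], [u], [v] in
    turn. *)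
Lemma balanced_eqs : [/\ c = 2%:R * m, b1 = a, b2 = 0, b3 = 0 & b4 = 0].
Proof.
have eval s := coclosed_eval (fun k => nth 0 s k).
split.
- have := eval [:: x; z; y; u; v].
  rewrite /ce_sum4 /form_sq /= ?tab ?JE ?dotE ?b_orth //=; lra.
- have := eval [:: e; x; y; u; v].
  rewrite /ce_sum4 /form_sq /= ?tab ?JE ?dotE ?b_orth //=; lra.
- have := eval [:: e; x; z; u; v].
  rewrite /ce_sum4 /form_sq /= ?tab ?JE ?dotE ?b_orth //=; lra.
- have := eval [:: e; x; z; y; v].
  rewrite /ce_sum4 /form_sq /= ?tab ?JE ?dotE ?b_orth //=; lra.
- have := eval [:: e; x; z; y; u].
  rewrite /ce_sum4 /form_sq /= ?tab ?JE ?dotE ?b_orth //=; lra.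
Qed.

(** The left side is the trace of [ad x] on n/n^1 in the basis [e], [y], [u], [v]. *)
Lemma trace_eq : al - c + 2%:R * m = 0.
Proof.
pose Y := [tuple e; y; u; v].
pose M := \matrix_(i < 4, j < 4) g (lie x Y`_i) Y`_j.
have <- : \tr M = al - c + 2%:R * m.
  rewrite /mxtrace !big_ord_recl big_ord0 !mxE /= ?tab !dotE !b_orth //=; ring.
rewrite -(trace0 x); apply/esym; apply: (quot_trace_eq (Y := Y)).
- by rewrite -memvE frame_mem.
- by apply/subvP => _ /memv_imgP[w wn ->]; rewrite lfunE /=; apply: (idealP _ n_ideal).
- apply/subvP => _ /memv_imgP[_ /vlineP[k ->] ->].
  by rewrite lfunE /= lieZr z_central scaler0 mem0v.
- apply/eqP; rewrite eqEsubv subv_add; apply/andP; split.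
    rewrite -memvE frame_mem // andbT.
    by apply/span_subvP => w; rewrite !inE => /or4P[] /eqP->; apply: frame_mem.
  apply/subvP => w; rewrite mem_n => /eqP w0.
  rewrite (frame_expand w) !big_ord_recl big_ord0 /bump /= w0 scale0r add0r addr0.
  have zU : z \in (<<Y>> + <[z]>)%VS.
    by apply: (subvP (addvSr _ _)); apply: memv_line.
  have bU w' : w' \in Y -> w' \in (<<Y>> + <[z]>)%VS.
    by move=> w'Y; apply: (subvP (addvSl _ _)); apply: memv_span.
  by do !apply: memvD; apply: memvZ => //; apply: bU; rewrite !inE eqxx ?orbT.
- by rewrite dim_n dim_vline frame_neq0.
- move=> i; set w := ad _ _; have w0 : g w x = 0.
    rewrite /w lfunE; apply/lie_xn; apply: (subvP (_ : <<Y>> <= n)%VS).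
      by apply/span_subvP => w'; rewrite !inE => /or4P[] /eqP->; apply: frame_mem.
    by apply: memv_span; rewrite mem_nth.
  apply/vlineP; exists (g w z).
  under eq_bigr do rewrite mxE -[lie x _]lfunE -/w.
  rewrite {1}(frame_expand w) !big_ord_recl !big_ord0 /bump /= w0.
  apply: frame_ext => k k6; rewrite !dotE.
  by case: k k6 => [|[|[|[|[|[|//]]]]]] _; rewrite !b_orth //=; ring.
Qed.

(** Substituting c = 2 m in the trace gives al = 0. The z components of the Jacobi identity for [x],
    [e] and [y], [v], [u] in turn then read c^2 = 0, t p = 0 and t q = 0. *)
Lemma structure_eqs : [/\ c = 0, m = 0, al = 0, t * p = 0 & t * q = 0].
Proof.
have [cE b1E b2E b3E b4E] := balanced_eqs.
have al0 : al = 0 by have := trace_eq; rewrite cE; lra.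
have c0 : c = 0.
  have := congr1 (g^~ z) (lie_der x e y); rewrite ?tab !(lieE, tab) !dotE !b_orth //=.
  rewrite al0 b2E b3E b4E => cc.
  by apply/eqP; rewrite -sqrf_eq0 expr2; apply/eqP; lra.
have m0 : m = 0 by lra.
split=> //.
  have := congr1 (g^~ z) (lie_der x e v); rewrite ?tab !(lieE, tab) !dotE !b_orth //=.
  rewrite al0 b2E b3E b4E m0 c0; lra.
have := congr1 (g^~ z) (lie_der x e u); rewrite ?tab !(lieE, tab) !dotE !b_orth //=.
rewrite al0 b2E b3E b4E m0 c0; lra.
Qed.

(** [d i j] is the wedge of the i-th and j-th dual frame covectors evaluated on [w], [w']; the
    formula collects all surviving structure constants. *)
Lemma frame_lie w w' (d := fun i j => g w (b i) * g w' (b j) - g w (b j) * g w' (b i)) :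
  lie w w' =
    (p * d 0%N 4%N + q * d 0%N 5%N + p1 * d 1%N 4%N + (p - p2) * d 1%N 5%N
       + a * (d 4%N 5%N - d 0%N 1%N)) *: z
    + (p2 * d 1%N 4%N + (p1 + q) * d 1%N 5%N) *: y
    - (t * d 1%N 5%N) *: u + (t * d 1%N 4%N) *: v.
Proof.
have [c0 m0 al0 _ _] := structure_eqs; have [_ b1E b2E b3E b4E] := balanced_eqs.
have -> : lie w w' = lie (\sum_(i < 6) g w (b i) *: b i) (\sum_(i < 6) g w' (b i) *: b i).
  by rewrite -!frame_expand.
rewrite !big_ord_recl !big_ord0 /bump /= !addr0 !lieE.
rewrite !(liexx, tab) (lieC u e) (lieC u x) (lieC v e) (lieC v x) (lieC v u).
rewrite (lieC u y) (lieC v y) !tab c0 m0 al0 b1E b2E b3E b4E {}/d.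
rewrite !(scale0r, scaler0, oppr0, addr0, add0r).
move: (g w e) (g w x) (g w u) (g w v) (g w' e) (g w' x) (g w' u) (g w' v).
move: a p q p1 p2 t => a' p' q' p1' p2' t' we wx wu wv we' wx' wu' wv'.
by apply: frame_ext => -[|[|[|[|[|[|//]]]]]] _; rewrite !dotE !b_orth //=; ring.
Qed.

Lemma y_central w : lie w y = 0.
Proof.
by rewrite frame_lie !b_orth //=; apply: frame_ext => i _; rewrite !dotE; ring.
Qed.

Hypothesis n_max : forall I : {vspace L},
  is_ideal I -> nilpotent_sub I -> (n <= I)%VS -> I = n.

(** If t = 0, all brackets lie in the span of the central [z] and [y]; the whole algebra is then
    nilpotent, and maximality would make it equal to n. *)
Lemma t_neq0 : t != 0.
Proof.
apply/eqP => t0; have : fullv = n.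
  apply: n_max; rewrite ?subvf //; first by rewrite /is_ideal subvf.
  exists 2%N; apply/eqP; rewrite -subv0.
  have s1 : (lcs fullv 1 <= <[z]> + <[y]>)%VS.
    apply/brs_subP => w w' _ _; rewrite frame_lie t0 !mul0r !scale0r oppr0 !addr0.
    by apply: memv_add; apply/memvZ/memv_line.
  apply/brs_subP => w w' _ /(subvP s1)/memv_addP[_ /vlineP[k ->] [_ /vlineP[l ->] ->]].
  by rewrite !lieE z_central y_central !scaler0 addr0 mem0v.
by move=> nE; move: dim_n; rewrite -nE dimL.
Qed.

Lemma p_q_eq0 : p = 0 /\ q = 0.
Proof.
have [_ _ _ /eqP + /eqP] := structure_eqs.
by rewrite !mulf_eq0 (negPf t_neq0) /= => /eqP-> /eqP->.
Qed.

(** As p = q = 0, brackets of vectors orthogonal to [x] are multiples of a z, so a = 0 would make n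
    abelian. *)
Lemma a_neq0 : a != 0.
Proof.
apply/eqP => a0; have : z \in lcs n 1 by rewrite n1E memv_line.
suff -> : lcs n 1 = 0%VS by rewrite memv0 (negPf (frame_neq0 _)).
apply/eqP; rewrite -subv0; apply/brs_subP => w w'; rewrite !mem_n => /eqP wx /eqP w'x.
have [p0 q0] := p_q_eq0; rewrite frame_lie a0 p0 q0 wx w'x memv0; apply/eqP.
by apply: frame_ext => i _; rewrite !dotE; ring.
Qed.

(* The coordinates in the basis f_1 = a z, f_2 = v + (p1 z + p2 y) / t,
   f_3 = u + (p2 z - p1 y) / t, f_4 = t e, f_5 = y, f_6 = x / t. *)
Definition frame_coord w : s516R R := \row_i
  [:: (g w z - (g w u * p2 + g w v * p1) / t) / a; g w v; g w u; g w e / t;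
      g w y + (g w u * p1 - g w v * p2) / t; t * g w x]`_i.

Fact frame_coord_linear : linear frame_coord.
Proof.
by move=> k w w'; apply/rowP => -[[|[|[|[|[|[|//]]]]]] ?]; rewrite !mxE /= !dotE; ring.
Qed.

HB.instance Definition _ :=
  GRing.isLinear.Build R L (s516R R) *:%R frame_coord frame_coord_linear.

Lemma frame_isog : lie_isog L (s516R R).
Proof.
have tn0 := t_neq0; have an0 := a_neq0; have [p0 q0] := p_q_eq0.
have ker0 : lker (linfun frame_coord) = 0%VS.
  apply/eqP; rewrite -subv0; apply/subvP => w; rewrite memv_ker lfunE /= memv0.
  move=> /eqP/rowP w0.
  have {}w0 i (i6 : (i < 6)%N) := w0 (Ordinal i6).
  have := (w0 0%N isT, w0 1%N isT, w0 2%N isT, w0 3%N isT, w0 4%N isT, w0 5%N isT).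
  rewrite !mxE /= => -[[[[[w1 w2] w3] w4] w5] w6].
  move: w1 w4 w5 w6; rewrite w2 w3 !mul0r subrr addr0 mul0r subr0 addr0.
  move/eqP; rewrite mulf_eq0 invr_eq0 (negPf an0) orbF => /eqP w1.
  move/eqP; rewrite mulf_eq0 invr_eq0 (negPf tn0) orbF => /eqP w4 w5.
  move/eqP; rewrite mulf_eq0 (negPf tn0) /= => /eqP w6; apply/eqP.
  by apply: frame_ext => -[|[|[|[|[|[|//]]]]]] _; rewrite dot0l.
exists (linfun frame_coord); split=> //.
  apply/eqP; rewrite eqEdim subvf /=.
  by rewrite limg_dim_eq ?dimL ?ker0 ?capv0 // dimvf dim_matrix.
move=> w w'; rewrite !lfunE /=.
apply/rowP => -[[|[|[|[|[|[|//]]]]]] ?];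
  rewrite !mxE /= ?/fw /fd ?mxE ?inordK //= frame_lie !dotE !b_orth //= p0 q0;
  by field; rewrite ?an0 ?tn0.
Qed.
End Consequences.
End AdaptedFrame.

(** * Construction of the adapted frame and conclusion *)

Lemma balanced_isog (R : realType) (L : lieAlgType R) (n : {vspace L})
    (J : 'End(L)) (g : {dot L for idfun}) :
  \dim {:L} = 6%N -> almost_nilpotent n -> strongly_unimodular n ->
  \dim (lcs n 1) = 1%N -> balanced J g -> (J @: lcs n 1 <= n)%VS ->
  lie_isog L (s516R R).
Proof.
move=> dimL [_ [n_ideal n_nil n_max] dim_n] unimod dim_n1 [herm cocl] Jn1.
have {}dim_n : \dim n = 5%N by apply: succn_inj; rewrite dim_n.
have [[JK _] gJ] := herm.
have gJl w w' : g (J w) w' = - g w (J w').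
  by rewrite -gJ JK dotNl.
have gJ0 w : g w (J w) = 0.
  by have := gJl w w; rewrite dotC; lra.
have [x xx xn] : exists2 x, g x x = 1 & forall i : 'I_(\dim n), g x (vbasis n)`_i = 0.
  by apply: exists_unit_orth; rewrite dim_n dimL.
pose f := linfun (dot_row g [tuple x]).
have memf w : (w \in lker f) = (g w x == 0).
  rewrite memv_ker lfunE /=.
  apply/eqP/eqP => [/rowP/(_ ord0)|w0]; first by rewrite !mxE.
  by apply/rowP => i; rewrite !mxE ord1.
have mem_n w : (w \in n) = (g w x == 0).
  rewrite -memf; suff -> : n = lker f by [].
  apply/eqP; rewrite eqEdim; apply/andP; split.
    rewrite -(span_basis (vbasisP n)); apply/span_subvP => _ /(nthP 0)[i + <-].
    by rewrite size_tuple => i_lt; rewrite memf dotC (xn (Ordinal i_lt)).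
  (* The kernel of g(., x) omits [x], so its dimension is at most 5, that of n. *)
  rewrite dim_n -ltnS -dimL ltn_neqAle dimvS ?subvf // andbT.
  apply/eqP => dE; have : lker f = fullv by apply/eqP; rewrite eqEdim subvf dE /=.
  by move/vspaceP/(_ x); rewrite memvf memf xx oner_eq0.
have {}xn w : w \in n -> g x w = 0 by rewrite mem_n dotC => /eqP.
have [z zn1 zz] : exists2 z, z \in lcs n 1 & g z z = 1.
  by apply: exists_unit; rewrite -dimv_eq0 dim_n1.
have z_ne0 : z != 0.
  by apply/eqP => z0; move/eqP: zz; rewrite z0 dot0l eq_sym oner_eq0.
have zn : z \in n by apply: (subvP (lcs_sub 0 n_ideal)).
(* The assumption on J n^1 enters here: it makes J z orthogonal to [x]. *)
have yn : J z \in n by apply: (subvP Jn1); apply: memv_img.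
pose e := - J x.
have Je : J e = x by rewrite /e linearN /= JK opprK.
(* The first four vectors span a J-stable subspace, so J u is orthogonal to it as well. *)
have [u uu uX] : exists2 u, g u u = 1 &
    forall i : 'I_4, g u [tuple e; x; z; J z]`_i = 0.
  by apply: exists_unit_orth; rewrite dimL.
have ue : g u e = 0 by exact: (uX (@Ordinal 4 0 isT)).
have ux : g u x = 0 by exact: (uX (@Ordinal 4 1 isT)).
have uz : g u z = 0 by exact: (uX (@Ordinal 4 2 isT)).
have uy : g u (J z) = 0 by exact: (uX (@Ordinal 4 3 isT)).
pose b := nth 0 [:: e; x; z; J z; u; J u].
apply: (@frame_isog _ L n J g b) => //.
- move=> i j; wlog ij : i j / (i <= j)%N => [H i6 j6|].
    case: (leqP i j) => [|/ltnW] ij; first exact: H.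
    by rewrite dotC H // eq_sym.
  have eE w : g e w = g x (J w) by rewrite dotNl gJl opprK.
  have Ju w : g w (J u) = - g u (J w) by rewrite dotC gJl.
  have xz := xn _ zn; have xy := xn _ yn; have zy := gJ0 z; have uv := gJ0 u.
  have xu : g x u = 0 by rewrite dotC.
  have zu : g z u = 0 by rewrite dotC.
  have yu : g (J z) u = 0 by rewrite dotC.
  have eu : g e u = 0 by rewrite dotC.
  have ee : g e e = 1 by rewrite eE Je.
  have ex : g e x = 0 by rewrite eE gJ0.
  have ez : g e z = 0 by rewrite eE.
  have ey : g e (J z) = 0 by rewrite eE JK dotNr xz oppr0.
  have ev : g e (J u) = 0 by rewrite Ju Je ux oppr0.
  have xv : g x (J u) = 0 by rewrite -eE.
  have zv : g z (J u) = 0 by rewrite Ju uy oppr0.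
  have yv : g (J z) (J u) = 0 by rewrite gJ.
  have yy : g (J z) (J z) = 1 by rewrite gJ.
  have vv : g (J u) (J u) = 1 by rewrite gJ.
  by case: i ij => [|[|[|[|[|[|//]]]]]]; case: j => [|[|[|[|[|[|//]]]]]].
- by rewrite -(vspace_dim1 dim_n1 zn1 z_ne0).
- by move=> w; apply: (lcs1_central n_ideal n_nil unimod dim_n1).
- by move: cocl; rewrite dimL.
- by move=> w; rewrite -(vspace_dim1 dim_n1 zn1 z_ne0); apply: (unimod w 0%N).
Qed.

Theorem theorem6p7 (R : realType) (L : lieAlgType R) (n : {vspace L})
    (dimL : \dim {:L} = 6%N) (nilL : almost_nilpotent n)
    (unimodL : strongly_unimodular n) (dim_n1 : \dim (lcs n 1) = 1%N) :
  [/\ ((exists (J : 'End(L)) (g : {dot L for idfun}),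
          balanced J g /\ (J @: lcs n 1 <= n)%VS) /\
       ~ (exists (J : 'End(L)) (g : {dot L for idfun}), kaehler J g))
      <-> lie_isog L (s516R R),
      lie_isog L (s516R R) ->
        [/\ decomposable L, step_solvable L 3, type_I L
          & isog_sub (h3 R * abelian_lie R 2)%type n]
    & balanced (J_ex R) (@g_ex R) /\
      (forall m : {vspace s516R R},
         is_nilradical m -> (J_ex R @: lcs m 1 <= m)%VS)].
Proof.
have [_ nil_n _] := nilL; split.
- split=> [[[J [g [bal Jn1]]] _]|[phi [inj surj morph]]].
    exact: (balanced_isog dimL nilL unimodL dim_n1 bal Jn1).
  split; first exact: (ex_balanced inj surj morph).
  exact: (not_kaehler inj surj morph).
- move=> [phi [inj surj morph]]; split.
  + exact: (s516_decomposable inj surj morph).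
  + exact: (s516_step_solvable inj surj morph).
  + exact: (s516_type_I inj morph).
  + exact: (s516_nilradical inj surj morph).
(* The example is the case of the coordinate lemmas in which [phi] is the identity. *)
- have ker1 : lker (\1%VF : 'End(s516R R)) = 0%VS.
    by apply/eqP/lker0P => x y; rewrite !lfunE.
  have lim1 : limg (\1%VF : 'End(s516R R)) = fullv.
    by apply: lker0_limgf; rewrite ker1.
  have lie1 (x y : s516R R) : \1%VF (lie x y) = lie (\1%VF x) (\1%VF y).
    by rewrite !lfunE.
  have J1 (x : s516R R) : \1%VF (J_ex R x) = J_ex R (\1%VF x) by rewrite !lfunE.
  have g1 (x y : s516R R) : g_ex x y = g_ex (\1%VF x) (\1%VF y) by rewrite !lfunE.
  split; first by apply: (s516_balanced ker1 lie1 J1 g1); rewrite dimvf.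
  by move=> m nil_m; apply: (J_lcs1 ker1 lim1 lie1 J1).
Qed.
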